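(* For every integer $d\ge 1$ there exist constants $B,C_1,C_2>0$, depending only on $d$, such that for all $N\in\mathbb{N}$ large enough and for all $t\ge 0$, $$C_1\,(1\wedge t)\,\Xi(t)\;\le\;\mathbb{E}\Bigl[\Bigl\|\frac{\eta_t(0,\cdot)}{\pi}-\frac{\pi_t(0,\cdot)}{\pi}\Bigr\|_2^2\Bigr]\;\le\; C_2\,(1\wedge t)\,\Xi(t)\,\exp\Bigl(\frac{Bt}{N^{d+2}}\Bigr),$$ where $$\Xi(t)=\frac{N^d\exp(-2t/t_{\rm rel})}{\bigl(N^{d+2}\wedge t^{d/2+1}\bigr)\vee 1},\qquad t_{\rm rel}=\frac{1}{1-\cos(2\pi/N)},$$ $\eta_t(0,\cdot)$ is the averaging process on $\mathbb{T}^d_N$ started from the unit mass at $0$, $\pi_t(0,\cdot)$ is the law at time $t$ of the random walk $\mathrm{RW}(\mathbb{T}^d_N)$ started from $0$, and $\pi$ is the uniform distribution on $\mathbb{T}^d_N$.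
   Context: $\mathbb{T}^d_N=(\mathbb{Z}/N\mathbb{Z})^d$ is the discrete torus with graph distance $|x-y|$ (nearest neighbors are pairs with $|x-y|=1$); $\pi\equiv N^{-d}$ is the uniform distribution on it; $\mathcal{P}(\mathbb{T}^d_N)$ is the set of probability mass functions on $\mathbb{T}^d_N$; $\|\psi\|_2=\bigl(\sum_{x}\pi(x)|\psi(x)|^2\bigr)^{1/2}$ is the $L^2$-norm on $(\mathbb{T}^d_N,\pi)$. Averaging process: the Markov jump process on $\mathcal{P}(\mathbb{T}^d_N)$ with generator $\mathcal{L}f(\eta)=\frac12\sum_{x\in\mathbb{T}^d_N}\sum_{y:|x-y|=1}\bigl(f(\eta^{xy})-f(\eta)\bigr)$ for continuous $f$, where $\eta^{xy}(z)=\frac12(\eta(x)+\eta(y))$ if $z\in\{x,y\}$ and $\eta^{xy}(z)=\eta(z)$ otherwise. That is, each unordered nearest-neighbor pair has an independent rate-1 Poisson clock, and when it rings the two masses are replaced by their average. $\mathbb{P},\mathbb{E}$ are the law and expectation of the random updates. $\eta_t(0,\cdot)$ denotes the process at time $t$ started from the Dirac mass $\mathbf{1}_0$ at $0\in\mathbb{T}^d_N$. $\mathrm{RW}(\mathbb{T}^d_N)$: the continuous-time random walk with generator $L^{\rm RW}\psi(x)=\frac12\sum_{y:|x-y|=1}(\psi(y)-\psi(x))$; $\pi_t(0,x)=\mathbf{P}^{\rm RW}_0(X_t=x)$ is its law at time $t$ started from $0$; $t_{\rm rel}$ is its relaxation time (inverse of its spectral gap $\lambda=1-\cos(2\pi/N)$).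 Notation: $a\wedge b=\min\{a,b\}$, $a\vee b=\max\{a,b\}$. *)

(* Defs.v *)
From HB Require Import structures.
From mathcomp Require Import all_boot all_order all_algebra.
From mathcomp Require Import all_classical all_reals all_analysis.

Set Implicit Arguments.
Unset Strict Implicit.
Unset Printing Implicit Defensive.

Import Order.TTheory GRing.Theory Num.Theory.
Import numFieldNormedType.Exports.

Local Open Scope classical_set_scope.
Local Open Scope ring_scope.

Section feller.
Context {R : realType} {S : topologicalType}.
Implicit Types (f g : S -> R) (Pt : R -> (S -> R) -> (S -> R)).

(* Feller semigroup on C(S), for S compact. The operators are total on S -> R,
   but only their action on continuous functions at times t >= 0 is constrained. *)
Record feller_semigroup Pt : Prop := FellerSemigroup {
  feller_continuous : forall t f, 0 <= t -> continuous f -> continuous (Pt t f) ;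
  feller_linear : forall t (a : R) f g, 0 <= t -> continuous f -> continuous g ->
    forall x, Pt t (fun y => a * f y + g y) x = a * Pt t f x + Pt t g x ;
  feller_ge0 : forall t f, 0 <= t -> continuous f ->
    (forall x, 0 <= f x) -> forall x, 0 <= Pt t f x ;
  feller_1 : forall t x, 0 <= t -> Pt t (fun=> 1) x = 1 ;
  feller_0 : forall f x, continuous f -> Pt 0 f x = f x ;
  feller_add : forall s t f x, 0 <= s -> 0 <= t -> continuous f ->
    Pt (s + t) f x = Pt s (Pt t f) x ;
  feller_cvg : forall f, continuous f -> {uniform, Pt ^~ f @ 0^'+ --> f} }.

(* G is the generator of Pt, with domain all of C(S): the generators of the
   jump processes considered here are bounded. *)
Definition has_generator Pt (G : (S -> R) -> (S -> R)) : Prop :=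
  forall f, continuous f ->
    {uniform, (fun t x => (Pt t f x - f x) / t) @ 0^'+ --> G f}.

End feller.

Section markov.
Context {R : realType} {S : topologicalType} {dO : measure_display}
  {Om : measurableType dO}.
Implicit Types (P : probability Om R) (X : R -> Om -> S).

Definition natural_filtration X (s : R) : set (set Om) :=
  <<s [set A | exists u U, [/\ 0 <= u, u <= s, open U & A = X u @^-1` U]] >>.

(* The last clause is E[f(X_{s+t}) | F_s] = (Pt t f)(X_s) almost surely. *)
Definition markov_property P X (Pt : R -> (S -> R) -> (S -> R)) : Prop :=
  (forall t U, 0 <= t -> open U -> measurable (X t @^-1` U)) /\
  forall s t f A, 0 <= s -> 0 <= t -> continuous f -> natural_filtration X s A ->
    (\int[P]_(w in A) (f (X (s + t) w))%:E =
     \int[P]_(w in A) (Pt t f (X s w))%:E)%E.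

(* Right-continuous step function on [0, +oo[ whose jump times do not
   accumulate. *)
Definition jump_path (p : R -> S) : Prop :=
  (forall t, 0 <= t -> \forall u \near t^'+, p u = p t) /\
  (forall t, 0 < t -> exists z, \forall u \near t^'-, p u = z).

Definition markov_jump_process P X (G : (S -> R) -> (S -> R)) (x0 : S) : Prop :=
  [/\ exists Pt, [/\ feller_semigroup Pt, has_generator Pt G &
                    markov_property P X Pt],
      {ae P, forall w, jump_path (X ^~ w)} &
      {ae P, forall w, X 0 w = x0}].

End markov.

(* 'Z_N is Z/NZ only for N >= 2. *)
Notation torus d N := {ffun 'I_d -> 'Z_N}.

(* The cyclic distance from a to b in Z/NZ is the smaller of the representatives
   of a - b and b - a in {0, ..., N-1}; the graph distance on the torus is the
   sum of these over the coordinates. *)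
Definition torus_dist (d N : nat) (x y : torus d N) : nat :=
  (\sum_(i < d) minn (x i - y i)%R (y i - x i)%R)%N.

Section prob_mass_space.
Context (R : realType) (T : finType).

Definition pmf_set : set {ptws T -> R} :=
  [set p | (forall x, 0 <= p x) /\ \sum_x p x = 1].

(* Carries the subspace topology of the product topology on R^T. *)
Definition prob_mass : topologicalType := set_type pmf_set.

Definition pmf_fun (p : prob_mass) : T -> R := set_val p.

Lemma dirac_pmf_subproof (a : T) : pmf_set (fun x => (x == a)%:R).
Proof.
split=> [x|]; first by rewrite ler0n.
by rewrite (bigD1 a) //= eqxx big1 ?addr0 // => x /negbTE ->.
Qed.

Definition dirac_pmf (a : T) : prob_mass := SigSub (mem_set (dirac_pmf_subproof a)).

Definition average_at (x y : T) (p : T -> R) : T -> R :=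
  fun z => if (z == x) || (z == y) then (p x + p y) / 2 else p z.

Lemma average_at_subproof (x y : T) (p : prob_mass) : pmf_set (average_at x y (pmf_fun p)).
Proof.
have [p0 p1] := set_mem (valP p); rewrite -/(pmf_fun p) in p0 p1.
split=> [z|].
  by rewrite /average_at; case: ifP => _; rewrite ?divr_ge0 ?addr_ge0 ?p0.
rewrite -p1; have [->|xy] := eqVneq x y.
  apply: eq_bigr => z _; rewrite /average_at orbb; case: eqP => [->|//].
  by rewrite mulrDl -splitr.
rewrite (bigD1 x) //= (bigD1 y) 1?eq_sym //= [RHS](bigD1 x) //=.
rewrite [in RHS](bigD1 y) 1?eq_sym //= /average_at !eqxx orbT /= !addrA -splitr.
congr (_ + _); apply: eq_bigr => z /andP[/negbTE -> /negbTE ->] //.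
Qed.

Definition average_pmf (x y : T) (p : prob_mass) : prob_mass :=
  SigSub (mem_set (average_at_subproof x y p)).

Definition l2norm (pi psi : T -> R) : R :=
  Num.sqrt (\sum_x pi x * `|psi x| ^+ 2).

End prob_mass_space.

Section torus_processes.
Context {R : realType} {d N : nat}.

Definition averaging_generator (f : prob_mass R (torus d N) -> R) :
    prob_mass R (torus d N) -> R :=
  fun eta => 2^-1 * \sum_(x : torus d N) \sum_(y | torus_dist x y == 1%N)
    (f (average_pmf x y eta) - f eta).

Definition rw_generator (psi : discrete_topology (torus d N) -> R) :
    discrete_topology (torus d N) -> R :=
  fun x => 2^-1 * \sum_(y : torus d N | torus_dist x y == 1%N) (psi y - psi x).

Context {dO : measure_display} {Om : measurableType dO}.

Definition averaging_process (P : probability Om R)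
    (eta : R -> Om -> prob_mass R (torus d N)) (eta0 : prob_mass R (torus d N)) : Prop :=
  markov_jump_process P eta averaging_generator eta0.

Definition random_walk (P : probability Om R)
    (X : R -> Om -> discrete_topology (torus d N)) (x0 : torus d N) : Prop :=
  markov_jump_process P X rw_generator x0.

Definition rw_law (P : probability Om R)
    (X : R -> Om -> discrete_topology (torus d N)) (t : R) (x : torus d N) : R :=
  fine (P [set w | X t w = x]).

End torus_processes.

Section rates.
Context (R : realType) (d N : nat).

Definition unif (x : torus d N) : R := (N%:R ^+ d)^-1.

Definition t_rel : R := (1 - cos (2 * pi / N%:R))^-1.

Definition Xi (t : R) : R :=
  N%:R ^+ d * expR (- 2 * t / t_rel) /
  Num.max (Num.min (N%:R ^+ (d + 2)) (t `^ (d%:R / 2 + 1))) 1.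

End rates.

(* Main.v *)
Require Import Defs.
From mathcomp Require Import all_boot all_order all_algebra.
From mathcomp Require Import all_classical all_reals all_analysis.
From mathcomp Require Import perm measurable_realfun zify ring lra.

(* Let lambda(k) be the eigenvalue of the walk at the frequency k. The mean
   squared modulus E_k of the k-th Fourier coefficient of the averaging process
   satisfies E_k' = - 2 lambda(k) E_k + sum_i mu(k_i) r_i, where the source
   sum_i r_i is itself S = N^-d sum_k lambda(k) E_k, and by Parseval the error
   is the sum over k of E_k - exp(- 2 lambda(k) t). Duhamel's formula turns this
   into the renewal equation S = d K + (- K' / 2) * S, where K is a one-point
   difference of the heat kernel, and the error divided by N^d is S * K.
   As S >= d K, the lower bound reduces to a lower bound on K. For the upper
   bound, the kernel - K' / 2 has mass 1/2, and tilting by exp(rho t) with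
   rho = 2 mu_1 - N^-(d+2) keeps its mass below 3/5 and makes S integrable; a
   splitting of the convolution at a t, with a close to 1, then gives S the same
   decay as K. All convolution integrals are replaced by monotonicity of explicit
   functions of time. *)

Set Implicit Arguments.
Unset Strict Implicit.
Unset Printing Implicit Defensive.

Import Order.TTheory GRing.Theory Num.Theory.
Import numFieldNormedType.Exports.

Local Open Scope classical_set_scope.
Local Open Scope ring_scope.

(** * Feller semigroups and their generators *)

(** The equations for the E_k close because lambda is invariant under permutations of the
    coordinates: against a weight that depends on lambda alone, mu(k_i) can be replaced by lambda(k)
    / d, so that only the total source enters.

    The obstacle is to keep the sharp rate 2 mu_1 = 2 / t_rel. After tilting by exp(rho t), the
    integral of K becomes a sum over modes of lambda / (2 lambda - rho), divided by d N^d. Terms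
    with lambda at least 2 mu_1 are at most 1, but the 2d modes with lambda = mu_1 add 2 mu_1 /
    (theta N^d), where theta = 2 mu_1 - rho. Since mu_1 is of order N^-2, theta = N^-(d+2) is the
    smallest order that keeps this bounded; it produces the factor exp(B t / N^(d+2)), with B = 1.

    The transfer of decay from K to S is a contraction. Late source times return the unknown ratio
    of the tilted S to the decay, multiplied by 3/4; early ones see the kernel only after time (1 -
    a) t, where its decay is known. Iterating from a crude bound on S removes the crude constant. *)

Section real_derivatives.
Context {R : realType}.
Implicit Types (f df : R -> R) (a b e : R).

Lemma is_derive_of_error f a l :
  (forall e, 0 < e -> exists2 r, 0 < r & forall h, h != 0 -> `|h| < r ->
     `|f (a + h) - f a - h * l| <= e * `|h|) ->
  is_derive a 1 f l.
Proof.
move=> H.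
have cv : h^-1 *: (f (h *: 1 + a) - f a) @[h --> 0^'] --> l.
  apply/cvgrPdist_le => e e0; have [r r0 Hr] := H _ e0.
  near=> h.
  have h0 : h != 0 by near: h; exact: nbhs_dnbhs_neq.
  have hr : `|h| < r.
    near: h; apply: dnbhs0_lt => //.
  rewrite -(ler_pM2r (_ : 0 < `|h|)) ?normr_gt0// -normrM.
  apply: le_trans (Hr h h0 hr); rewrite -normrN le_eqVlt; apply/orP; left.
  apply/eqP; congr (`|_|); rewrite [h *: 1]mulr1 [h + a]addrC /GRing.scale/=.
  by field.
by split; [apply/cvg_ex; exists l|exact/cvg_lim].
Unshelve. all: by end_near. Qed.

Lemma derive_le0_le f df a b : a <= b ->
  (forall x, a <= x <= b -> is_derive x 1 f (df x)) ->
  (forall x, a < x < b -> df x <= 0) -> f b <= f a.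
Proof.
move=> ab Hd Hn; have [->//|anb] := eqVneq a b.
have lab : a < b by rewrite lt_neqAle anb.
have [||c] := @MVT R f df a b lab.
- by move=> x; rewrite in_itv/= => /andP[/ltW ax /ltW xb]; apply: Hd; rewrite ax.
- apply: derivable_within_continuous => x; rewrite in_itv/= => xab.
  by have [] := Hd x xab.
rewrite in_itv/= => /Hn dc E; rewrite -subr_le0 E.
by rewrite mulr_le0_ge0// subr_ge0.
Qed.

Lemma derive_ge0_le f df a b : a <= b ->
  (forall x, a <= x <= b -> is_derive x 1 f (df x)) ->
  (forall x, a < x < b -> 0 <= df x) -> f a <= f b.
Proof.
move=> ab Hd Hn; rewrite -lerN2.
apply: (@derive_le0_le (- f) (- df)) => // x /[dup] xab; last first.
  by move/Hn; rewrite oppr_le0.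
by move=> /Hd ?; apply: is_deriveN.
Qed.

End real_derivatives.

Section feller_theory.
Context {R : realType} {S : topologicalType}.
Context (Pt : R -> (S -> R) -> (S -> R)) (PtF : feller_semigroup Pt).
Implicit Types (f g : S -> R).

Lemma sum_continuous (I : Type) (r : seq I) (P : pred I) (F : I -> S -> R) :
  (forall i, continuous (F i)) -> continuous (fun y => \sum_(i <- r | P i) F i y).
Proof.
move=> cF; apply: (@continuous_big _ _ +%R 0) => // x.
exact: add_continuous.
Qed.

Lemma cst_fun_continuous (c : R) : continuous (fun _ : S => c).
Proof. by move=> y; exact: cvg_cst. Qed.

Lemma add_fun_continuous f g : continuous f -> continuous g ->
  continuous (fun y => f y + g y).
Proof. by move=> cf cg y; exact: cvgD (cf y) (cg y). Qed.

Lemma sub_fun_continuous f g : continuous f -> continuous g ->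
  continuous (fun y => f y - g y).
Proof. by move=> cf cg y; exact: cvgB (cf y) (cg y). Qed.

Lemma mul_fun_continuous f g : continuous f -> continuous g ->
  continuous (fun y => f y * g y).
Proof. by move=> cf cg y; exact: cvgM (cf y) (cg y). Qed.

Lemma feller_cst t (c : R) x : 0 <= t -> Pt t (fun=> c) x = c.
Proof.
move=> t0; have c1 : continuous (fun _ : S => 1 : R) by move=> y; exact: cvg_cst.
have := feller_linear PtF (-1) t0 c1 c1 x; rewrite (feller_1 PtF) // => E0.
have c2 : continuous (fun _ : S => -1 * 1 + 1 : R) by move=> y; exact: cvg_cst.
have := feller_linear PtF c t0 c1 c2 x.
by rewrite E0 (feller_1 PtF) // !mulr1 addNr addr0.
Qed.

Lemma feller_add_fun t f g x : 0 <= t -> continuous f -> continuous g ->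
  Pt t (fun y => f y + g y) x = Pt t f x + Pt t g x.
Proof.
move=> t0 cf cg; have := feller_linear PtF 1 t0 cf cg x.
by rewrite mul1r => <-; congr (Pt t _ x); apply/funext => y; rewrite mul1r.
Qed.

Lemma feller_scale t a f x : 0 <= t -> continuous f ->
  Pt t (fun y => a * f y) x = a * Pt t f x.
Proof.
move=> t0 cf; have c0 : continuous (fun _ : S => 0 : R) by move=> y; exact: cvg_cst.
have := feller_linear PtF a t0 cf c0 x; rewrite feller_cst// addr0 => <-.
by congr (Pt t _ x); apply/funext => y; rewrite addr0.
Qed.

Lemma feller_sub t f g x : 0 <= t -> continuous f -> continuous g ->
  Pt t (fun y => f y - g y) x = Pt t f x - Pt t g x.
Proof.
move=> t0 cf cg; have := feller_linear PtF (-1) t0 cg cf x.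
rewrite mulN1r addrC => <-; congr (Pt t _ x).
by apply/funext => y; rewrite mulN1r addrC.
Qed.

Lemma feller_sum (I : Type) (r : seq I) (P : pred I) (F : I -> S -> R) t x :
  0 <= t -> (forall i, continuous (F i)) ->
  Pt t (fun y => \sum_(i <- r | P i) F i y) x = \sum_(i <- r | P i) Pt t (F i) x.
Proof.
move=> t0 cF; elim: r => [|i r IH].
  rewrite big_nil -[RHS](feller_cst 0 x t0); congr (Pt t _ x).
  by apply/funext => y; rewrite big_nil.
rewrite big_cons -IH; case: ifP => Pi; last first.
  by congr (Pt t _ x); apply/funext => y; rewrite big_cons Pi.
rewrite -feller_add_fun//.
  by congr (Pt t _ x); apply/funext => y; rewrite big_cons Pi.
exact: sum_continuous.
Qed.

Lemma feller_bound t f e x : 0 <= t -> continuous f ->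
  (forall y, `|f y| <= e) -> `|Pt t f x| <= e.
Proof.
move=> t0 cf fe; have ce : continuous (fun _ : S => e) by move=> y; exact: cvg_cst.
rewrite ler_norml; apply/andP; split.
  rewrite -subr_ge0 opprK -(feller_cst e x t0) -feller_add_fun//.
  apply: (feller_ge0 PtF) => // [|y]; first by move=> y; exact: cvgD (cf y) (ce y).
  by have := fe y; rewrite ler_norml -lerBlDr sub0r => /andP[].
rewrite -subr_ge0 -(feller_cst e x t0) -feller_sub//.
apply: (feller_ge0 PtF) => // [|y]; first by move=> y; exact: cvgB (ce y) (cf y).
by have := fe y; rewrite ler_norml subr_ge0 => /andP[].
Qed.

Lemma uniform_right_cvgP (F : R -> S -> R) (f : S -> R) :
  {uniform, F @ 0^'+ --> f} ->
  forall e, 0 < e -> exists2 r, 0 < r & forall h, 0 < h -> h < r ->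
    forall y, `|F h y - f y| <= e.
Proof.
move=> cF e e0.
have : \forall h \near 0^'+, forall y, `|F h y - f y| <= e.
  apply: (cF (fun g : S -> R => forall y, `|g y - f y| <= e)).
  rewrite uniform_nbhs; exists [set xy | `|xy.2 - xy.1| < e]; split => /=.
    by rewrite -entourage_ballE; exists e => //= -[u v]/=; rewrite /ball/= distrC.
  by move=> g /= Hg y; apply/ltW/Hg.
move=> [r /= r0 Hr]; exists r => // h h0 hr; apply: Hr => //=.
by rewrite /ball/= sub0r normrN gtr0_norm.
Qed.

Context (G : (S -> R) -> (S -> R)) (GP : has_generator Pt G).

(* Prolonging the orbit affinely to negative times makes it differentiable,
   in the two-sided sense, also at time 0. *)
Definition feller_orbit f x (t : R) : R :=
  if 0 <= t then Pt t f x else f x + t * G f x.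

Lemma feller_orbitE f x t : 0 <= t -> feller_orbit f x t = Pt t f x.
Proof. by rewrite /feller_orbit => ->. Qed.

Lemma feller_orbit0 f x : continuous f -> feller_orbit f x 0 = f x.
Proof. by move=> cf; rewrite feller_orbitE// (feller_0 PtF). Qed.

(** Kolmogorov's equation. The operators contract the supremum norm, so the uniform error of the
    generator at time 0 carries over to every time [s] ([step]); a negative increment is handled by
    running [step] from [t + h] and comparing the orbit of [G f] at the two times. *)
Lemma feller_orbit_derive f x (t : R) : continuous f -> continuous (G f) -> 0 <= t ->
  is_derive t 1 (feller_orbit f x) (feller_orbit (G f) x t).
Proof.
move=> cf cG t0; apply: is_derive_of_error => e e0.
have e20 : 0 < e / 2 by rewrite divr_gt0.
have [r1 r10 H1] := uniform_right_cvgP (GP cf) e20.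
have [r2 r20 H2] := uniform_right_cvgP (feller_cvg PtF cG) e20.
have step h s : 0 < h -> h < r1 -> 0 <= s ->
    `|Pt (s + h) f x - Pt s f x - h * Pt s (G f) x| <= e / 2 * h.
  move=> h0 hr s0; have ch := feller_continuous PtF (ltW h0) cf.
  have cfg : continuous (fun y => Pt h f y - f y).
    by move=> y; exact: cvgB (ch y) (cf y).
  have chG : continuous (fun y => h * G f y).
    by move=> y; apply: cvgM (cG y); exact: cvg_cst.
  rewrite (feller_add PtF) // ?(ltW h0)// -feller_sub// -feller_scale// -feller_sub//.
  apply: feller_bound => // [y|y]; first exact: cvgB (cfg y) (chG y).
  have -> : Pt h f y - f y - h * G f y = ((Pt h f y - f y) / h - G f y) * h.
    by field; rewrite gt_eqF.
  by rewrite normrM (gtr0_norm h0) ler_wpM2r ?(ltW h0)// H1.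
(* For [t > 0] the radius [t] keeps [t + h] nonnegative. At [t = 0] a negative increment meets the
   affine prolongation, where the error vanishes. *)
exists (if t == 0 then r1 else Num.min t (Num.min r1 r2)).
  by case: eqP => // /eqP tn0; rewrite !lt_min r10 r20 !andbT lt_neqAle eq_sym tn0.
move=> h h0 hr; have [hp|hn] := ltP 0 h.
  have hr1 : h < r1.
    by move: hr; rewrite (gtr0_norm hp); case: ifP => // _; rewrite !lt_min => /and3P[].
  rewrite !feller_orbitE ?addr_ge0 ?(ltW hp)// (gtr0_norm hp).
  by apply: le_trans (step _ _ hp hr1 t0) _; rewrite ler_pM2r//; lra.
have {}hn : h < 0 by rewrite lt_neqAle h0.
move: hr; have [-> hr|tn0] := eqVneq t 0.
  have -> : feller_orbit f x (0 + h) = f x + h * G f x.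
    by rewrite /feller_orbit add0r leNgt hn.
  rewrite !feller_orbit0//.
  by rewrite addrAC addrK subrr normr0 mulr_ge0// ltW.
rewrite (ltr0_norm hn) !lt_min => /and3P[ht h1 h2].
have th : 0 <= t + h by lra.
have nh : 0 < - h by rewrite oppr_gt0.
rewrite !feller_orbitE//.
have A := step _ _ nh h1 th; rewrite addrK in A.
have B : `|Pt t (G f) x - Pt (t + h) (G f) x| <= e / 2.
  have -> : Pt t (G f) x = Pt ((t + h) + - h) (G f) x by rewrite addrK.
  rewrite (feller_add PtF) ?(ltW nh)//.
  have cn := feller_continuous PtF (ltW nh) cG.
  rewrite -feller_sub//; apply: feller_bound => // [y|y].
    exact: cvgB (cn y) (cG y).
  exact: H2.
have -> : Pt (t + h) f x - Pt t f x - h * Pt t (G f) x =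
  - (Pt t f x - Pt (t + h) f x - - h * Pt (t + h) (G f) x)
  + - h * (Pt t (G f) x - Pt (t + h) (G f) x) by ring.
apply: le_trans (ler_normD _ _) _; rewrite normrN normrM (gtr0_norm nh).
have := ler_wpM2l (ltW nh) B; lra.
Qed.

End feller_theory.

(** * Differentiation rules for functions of time *)

Section derivative_rules.
Context {R : realType}.
Implicit Types (f g : R -> R) (t c l : R).

Lemma is_derive_mulf f g t df dg : is_derive t 1 f df -> is_derive t 1 g dg ->
  is_derive t 1 (fun s => f s * g s) (df * g t + f t * dg).
Proof.
move=> hf hg; apply: is_derive_eq (is_deriveM hf hg) _.
by rewrite /GRing.scale/=; ring.
Qed.

Lemma is_derive_mulcf f t c df : is_derive t 1 f df ->
  is_derive t 1 (fun s => c * f s) (c * df).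
Proof.
move=> hf; have := is_derive_mulf (is_derive_cst c t 1) hf.
by rewrite mul0r add0r.
Qed.

Lemma is_derive_addf f g t df dg : is_derive t 1 f df -> is_derive t 1 g dg ->
  is_derive t 1 (fun s => f s + g s) (df + dg).
Proof. by move=> hf hg; exact: is_deriveD. Qed.

Lemma is_derive_subf f g t df dg : is_derive t 1 f df -> is_derive t 1 g dg ->
  is_derive t 1 (fun s => f s - g s) (df - dg).
Proof. by move=> hf hg; exact: is_deriveB. Qed.

Lemma is_derive_sumf (I : Type) (r : seq I) (P : pred I) (F : I -> R -> R) t
    (dF : I -> R) : (forall i, is_derive t 1 (F i) (dF i)) ->
  is_derive t 1 (fun s => \sum_(i <- r | P i) F i s) (\sum_(i <- r | P i) dF i).
Proof.
move=> H; elim: r => [|i r IH].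
  rewrite big_nil (_ : (fun _ => _) = cst 0); first exact: is_derive_cst.
  by apply/funext => s; rewrite big_nil.
rewrite big_cons; case: ifP => Pi.
  rewrite (_ : (fun _ => _) = fun s => F i s + \sum_(i <- r | P i) F i s).
    exact: is_derive_addf.
  by apply/funext => s; rewrite big_cons Pi.
rewrite (_ : (fun _ => _) = fun s => \sum_(i <- r | P i) F i s)//.
by apply/funext => s; rewrite big_cons Pi.
Qed.

Lemma is_derive_expc c b t :
  is_derive t 1 (fun s => expR (c * s + b)) (c * expR (c * t + b)).
Proof.
have h : is_derive t 1 (fun s => c * s + b) c.
  have := is_derive_addf (is_derive_mulcf c (is_derive_id t 1)) (is_derive_cst b t 1).
  by rewrite mulr1 addr0.
have := @is_derive1_comp _ _ (fun s => c * s + b) t _ _ (is_derive_expR _) h.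
by rewrite mulrC.
Qed.

Lemma ode_exp u l : (forall t, 0 <= t -> is_derive t 1 u (- l * u t)) ->
  forall t, 0 <= t -> u t = expR (- (l * t)) * u 0.
Proof.
move=> H t t0.
pose v s := expR (l * s + 0) * u s.
have dv s : 0 <= s <= t -> is_derive s 1 v 0.
  move=> /andP[s0 _]; have := is_derive_mulf (is_derive_expc l 0 s) (H _ s0).
  by move=> h; apply: is_derive_eq h _; ring.
have : v t = v 0.
  apply/eqP; rewrite eq_le; apply/andP; split.
    by apply: (@derive_le0_le _ _ (fun=> 0)).
  by apply: (@derive_ge0_le _ _ (fun=> 0)).
rewrite /v mulr0 !addr0 expR0 mul1r => <-.
by rewrite mulrA expRN mulVf ?mul1r// gt_eqF// expR_gt0.
Qed.

End derivative_rules.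

(** * Expectations of the process through its semigroup *)

Section markov_expectation.
Context {R : realType} {S : topologicalType} {dO : measure_display}
  {Om : measurableType dO} (P : probability Om R) (X : R -> Om -> S).

Lemma measurable_continuous_comp t (f : S -> R) :
  (forall U, open U -> measurable (X t @^-1` U)) -> continuous f ->
  measurable_fun setT (fun w => f (X t w)).
Proof.
move=> mX /continuousP cf; apply: (measurability _ (RGenOpens.measurableE R)).
move=> _ [_ [a [b ->] <-]]; rewrite setTI.
exact: (mX (f @^-1` _)) (cf _ (interval_open _ _)).
Qed.

(** This is the Markov property at [s = 0] on the whole space, combined with the almost sure initial
    value. *)
Lemma markov_expectation (Pt : R -> (S -> R) -> (S -> R)) (x0 : S) t f :
  feller_semigroup Pt -> markov_property P X Pt -> {ae P, forall w, X 0 w = x0} ->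
  0 <= t -> continuous f ->
  (\int[P]_w (f (X t w))%:E = (Pt t f x0)%:E)%E.
Proof.
move=> PtF [mX mk] X0 t0 cf.
have /= := mk 0 t f setT (lexx 0) t0 cf.
rewrite add0r => ->; last first.
  have -> : setT = setT `\` set0 :> set Om by rewrite setD0.
  apply: sigma_algebraCD; exact: sigma_algebra0.
rewrite (@ae_eq_integral _ _ _ P setT (cst (Pt t f x0)%:E))//.
- rewrite integral_cst// -[RHS]mule1; congr (_ * _)%E; exact: probability_setT.
- apply/measurable_EFinP; apply: measurable_continuous_comp => [U oU|].
    exact: mX.
  exact: feller_continuous.
- by apply: filterS X0 => w /= -> _.
Qed.

End markov_expectation.

(** * Fourier analysis on the torus *)

Section phases.
Context {R : realType} {d N : nat} (N_gt1 : (1 < N)%N).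
Implicit Types (k x y z : torus d N) (a b : R).

(** The pairing is computed on natural representatives; only its class modulo [N] enters the
    cosines, by [cos_addn_mod]. *)
Definition dotn k x : nat := (\sum_i k i * x i)%N.

Definition phase k x : R := 2 * pi / N%:R * (dotn k x)%:R.

Definition unit_vec (i : 'I_d) : torus d N := [ffun j => (j == i)%:R].

Definition mu1 (a : 'Z_N) : R := 1 - cos (2 * pi / N%:R * (a : nat)%:R).

Definition lam k : R := \sum_i mu1 (k i).

Let N0 : N%:R != 0 :> R.
Proof. by rewrite pnatr_eq0 -lt0n; apply: ltn_trans N_gt1. Qed.

(** The offset [b] makes one statement serve cosines and sines, the latter being [b = - (pi / 2)] by
    [sinE_cos]. *)
Lemma cos_addn_mod b (n m : nat) : n = m %[mod N] ->
  cos (b + 2 * pi / N%:R * n%:R) = cos (b + 2 * pi / N%:R * m%:R).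
Proof.
suff H q : cos (b + 2 * pi / N%:R * q%:R) = cos (b + 2 * pi / N%:R * (q %% N)%:R).
  by move=> E; rewrite H E -H.
rewrite [in LHS](divn_eq q N) natrD natrM.
have -> : b + 2 * pi / N%:R * ((q %/ N)%:R * N%:R + (q %% N)%:R) =
   b + 2 * pi / N%:R * (q %% N)%:R + (pi *+ 2) *+ (q %/ N) :> R.
  by rewrite -[pi *+ 2 *+ _]mulr_natr -[pi *+ 2]mulr_natr; field.
exact: (periodicn (@cosD2pi R)).
Qed.

Lemma dotnC k x : dotn k x = dotn x k.
Proof. by apply: eq_bigr => i _; rewrite mulnC. Qed.

Lemma phaseC k x : phase k x = phase x k.
Proof. by rewrite /phase dotnC. Qed.

Lemma val_ZpD (a b : 'Z_N) : ((a + b)%R : nat) = ((a + b)%N %% N)%N.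
Proof. by rewrite -[X in _ = (_ %% X)%N](Zp_cast N_gt1). Qed.

Lemma dotnD k x y : dotn k (x + y) = (dotn k x + dotn k y)%N %[mod N].
Proof.
rewrite /dotn -big_split/= -modn_summ -[in RHS]modn_summ; congr modn.
apply: eq_bigr => i _; rewrite ffunE val_ZpD modnMmr mulnDr.
by [].
Qed.

Lemma cos_phaseD b k x y : cos (b + phase k (x + y)) = cos (b + (phase k x + phase k y)).
Proof.
by rewrite /phase -mulrDr -natrD; apply: cos_addn_mod; exact: dotnD.
Qed.

Lemma dotn_unit k i : dotn k (unit_vec i) = k i.
Proof.
rewrite /dotn (bigD1 i)//= ffunE eqxx big1 ?addn0 => [|j ji].
  by rewrite -[X in _ = X]muln1; congr muln; rewrite /= modn_small//.
by rewrite ffunE (negbTE ji) muln0.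
Qed.

Lemma phase_unit k i : phase k (unit_vec i) = 2 * pi / N%:R * (k i : nat)%:R.
Proof. by rewrite /phase dotn_unit. Qed.

Lemma mu1E k i : mu1 (k i) = 1 - cos (phase k (unit_vec i)).
Proof. by rewrite phase_unit. Qed.

Lemma cos_phaseB b k x y : cos (b + phase k (x - y)) = cos (b + (phase k x - phase k y)).
Proof.
have := cos_phaseD (b - phase k y) k (x - y) y; rewrite subrK => E.
have -> : b + phase k (x - y) = b - phase k y + (phase k (x - y) + phase k y) by ring.
by rewrite -E; congr cos; ring.
Qed.

Lemma sinE_cos b : sin b = cos (- (pi / 2) + b).
Proof. by rewrite addrC cosBpihalf. Qed.

Lemma mu1_ge0 (a : 'Z_N) : 0 <= mu1 a.
Proof. by rewrite subr_ge0 cos_le1. Qed.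

Lemma lam_ge0 k : 0 <= lam k.
Proof. by apply: sumr_ge0 => i _; exact: mu1_ge0. Qed.

Lemma mu1_gt0 (n : nat) : (0 < n < N)%N -> 0 < 1 - cos (2 * pi / N%:R * n%:R) :> R.
Proof.
move=> /andP[n0 nN]; rewrite subr_gt0.
have Np : 0 < N%:R :> R by rewrite ltr0n; apply: ltn_trans N_gt1.
have s0 : 0 < sin (pi / N%:R * n%:R :> R).
  apply: sin_gt0_pi; rewrite mulr_gt0 ?divr_gt0 ?pi_gt0 ?Np ?ltr0n//=.
  by rewrite mulrAC ltr_pdivrMr// ltr_pM2l ?pi_gt0// ltr_nat.
set a := (X in cos X); have -> : a = (pi / N%:R * n%:R) *+ 2.
  by rewrite /a -[RHS]mulr_natr; field.
by rewrite cos_mulr2n cos2sin2; nra.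
Qed.

End phases.

(** * Nearest neighbours and the discrete Laplacian *)

Section neighbours.
Context {R : realType} {d N : nat} (N_gt2 : (2 < N)%N).
Implicit Types (k x y z : torus d N) (f g : torus d N -> R).

Let N_gt1 : (1 < N)%N. Proof. exact: ltn_trans N_gt2. Qed.

Let cyc (a : 'Z_N) : nat := minn a (- a)%R.

Lemma val_ZpN (a : 'Z_N) : ((- a)%R : nat) = ((N - a) %% N)%N.
Proof. by rewrite -[X in _ = ((X - _) %% X)%N](Zp_cast N_gt1). Qed.

Lemma ltn_ZpN (a : 'Z_N) : (a < N)%N.
Proof. by rewrite -[X in (_ < X)%N](Zp_cast N_gt1). Qed.

Lemma cyc0 a : (cyc a == 0%N) = (a == 0).
Proof.
rewrite /cyc val_ZpN; apply/idP/eqP => [|->]; last by rewrite min0n.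
have aN := ltn_ZpN a.
move=> H; apply/ord_inj => /=; move: H.
have [->//|a0] := eqVneq (a : nat) 0%N.
rewrite modn_small; lia.
Qed.

(** For [N = 2] the two neighbours along an axis would coincide and [sum_neighbours] would count
    them twice. *)
Lemma Zp1_neqN1 : (1 : 'Z_N) != -1.
Proof.
apply/eqP => /(congr1 (@nat_of_ord _)); rewrite val_ZpN /= modn_small// modn_small; lia.
Qed.

Lemma cyc1 a : (cyc a == 1%N) = (a == 1) || (a == -1).
Proof.
rewrite /cyc val_ZpN; have aN := ltn_ZpN a.
apply/idP/idP => [|/orP[]/eqP ->]; last 2 first.
- by rewrite /= (@modn_small 1)// modn_small; lia.
- rewrite val_ZpN /= (@modn_small 1)// (@modn_small (N - 1)%N) ?(@modn_small (N - (N - 1))%N); lia.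
have [->|a0] := eqVneq (a : nat) 0%N; first by rewrite min0n.
rewrite modn_small; last by lia.
move=> H; have [a1|aN1] : a = 1%N :> nat \/ a = (N - 1)%N :> nat by lia.
  by apply/orP; left; apply/eqP/ord_inj; rewrite /= a1 modn_small.
by apply/orP; right; apply/eqP/ord_inj; rewrite val_ZpN aN1 /= (@modn_small 1)// modn_small//; lia.
Qed.

Let nbr (p : 'I_d * bool) : torus d N :=
  if p.2 then unit_vec p.1 else - unit_vec p.1.

Let nbrE p j : nbr p j = if j == p.1 then (if p.2 then 1 else -1) else 0.
Proof.
by rewrite /nbr; case: p.2; rewrite !ffunE; case: eqP; rewrite ?oppr0.
Qed.

Let nbr_inj : injective nbr.
Proof.
move=> [i s] [j t] /ffunP E.
have o0 : (1 : 'Z_N) != 0 by rewrite oner_eq0.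
have on := Zp1_neqN1.
have := E i; rewrite !nbrE/= eqxx.
have [<-|ij] := eqVneq i j.
  by case: s {E}; case: t => // /eqP; rewrite 1?[-1 == 1]eq_sym (negbTE on).
by case: s {E} => /eqP; rewrite ?oppr_eq0 (negbTE o0).
Qed.

(** Distance 1 means that one coordinate moves by 1 or -1 and the others stay; [nbr] lists these
    differences without repetition. *)
Lemma sum_neighbours (F : torus d N -> R) x :
  \sum_(y | torus_dist x y == 1%N) F y =
  \sum_i (F (x + unit_vec i) + F (x - unit_vec i)).
Proof.
rewrite (reindex_inj (addrI x)).
transitivity (\sum_(z in nbr @: [set: 'I_d * bool]%SET) F (x + z)).
  apply: eq_bigl => z; rewrite /torus_dist.
  have -> : (\sum_(i < d) minn (x i - (x + z)%R i)%R ((x + z)%R i - x i)%R =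
     \sum_(i < d) cyc (z i))%N.
    apply: eq_bigr => i _; rewrite ffunE /cyc minnC.
    by rewrite opprD addNKr addrAC subrr add0r.
  apply/sum_nat_eq1/imsetP => [[i [_ /eqP]]|[[i s] _ ->]].
    rewrite cyc1 => zi z0.
    exists (i, z i == 1) => //;  apply/ffunP => j; rewrite nbrE/=.
    have [->|ji] := eqVneq j i; first by case: eqP zi => //= _ /eqP.
    by apply/eqP; rewrite -cyc0 z0.
  exists i; split => //= [|j ji _]; rewrite ?nbrE/=.
    by rewrite eqxx; apply/eqP; rewrite cyc1; case: s; rewrite eqxx ?orbT.
  by rewrite (negbTE ji); apply/eqP; rewrite cyc0.
rewrite big_imset; last by move=> ? ? _ _; exact: nbr_inj.
rewrite (eq_bigl predT) => [|p]; last by rewrite inE.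
rewrite -(pair_bigA _ (fun i s => F (x + nbr (i, s)))) /=.
by apply: eq_bigr => i _; rewrite big_bool.
Qed.

Lemma torus_distC x y : torus_dist x y = torus_dist y x.
Proof. by apply: eq_bigr => i _; rewrite minnC. Qed.

(** This is -2 times the generator of the walk, so that its eigenvalues [2 * lam k] are
    nonnegative. *)
Definition lapl f x : R := \sum_(y | torus_dist x y == 1%N) (f x - f y).

(** Discrete integration by parts: expand [f x - f y] and exchange the endpoints of each edge in the
    second half. *)
Lemma lapl_dirichlet f g :
  \sum_x \sum_(y | torus_dist x y == 1%N) (f x - f y) * (g x - g y) =
  2 * \sum_x f x * lapl g x.
Proof.
have E : \sum_x \sum_(y | torus_dist x y == 1%N) - f y * (g x - g y) =
    \sum_x f x * lapl g x.
  rewrite (exchange_big_dep predT)//=; apply: eq_bigr => x _.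
  rewrite /lapl mulr_sumr; apply: eq_big => y; first by rewrite torus_distC.
  by move=> _; ring.
rewrite mulr_natl mulr2n -[X in _ = _ + X]E -big_split /=.
apply: eq_bigr => x _; rewrite /lapl mulr_sumr -big_split /=.
by apply: eq_bigr => y _; ring.
Qed.

Lemma lapl_sym f g : \sum_x f x * lapl g x = \sum_x lapl f x * g x.
Proof.
apply: (@mulfI _ 2) => //; rewrite -lapl_dirichlet.
under [in RHS]eq_bigr do rewrite mulrC.
rewrite -lapl_dirichlet; apply: eq_bigr => x _; apply: eq_bigr => y _.
by rewrite mulrC.
Qed.

Lemma lapl_cos b k x :
  lapl (fun y => cos (b + phase k y)) x = 2 * lam k * cos (b + phase k x).
Proof.
rewrite /lapl sum_neighbours /lam mulr_sumr mulr_suml; apply: eq_bigr => i _.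
rewrite cos_phaseD// cos_phaseB// !addrA mu1E//.
by move: (b + phase k x) (phase k (unit_vec i)) => u v; rewrite cosD cosB; ring.
Qed.

End neighbours.

(** * Fourier coefficients, Parseval and the Dirichlet form *)

Section fourier.
Context {R : realType} {d N : nat} (N_gt2 : (2 < N)%N).
Implicit Types (k x y z : torus d N) (f g : torus d N -> R).

Let N_gt1 : (1 < N)%N. Proof. exact: ltn_trans N_gt2. Qed.

Lemma cos_phase_diff_neq1 i x y : x i != y i ->
  cos (phase (unit_vec i) x - phase (unit_vec i) y) < 1 :> R.
Proof.
rewrite ![phase (unit_vec i) _]phaseC !phase_unit// -mulrBr => xy.
have xN := ltn_ZpN N_gt2 (x i); have yN := ltn_ZpN N_gt2 (y i).
have xyn : (x i : nat) <> y i by move=> /ord_inj /eqP; apply/negP.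
rewrite -subr_gt0; have [lxy|lyx] := leqP (x i) (y i).
  by rewrite -[X in cos (_ * X)]opprB mulrN cosN -natrB//; apply: mu1_gt0 => //; lia.
by rewrite -natrB ?(ltnW lyx)//; apply: mu1_gt0 => //; lia.
Qed.

Lemma card_torus : #|{: torus d N}| = (N ^ d)%N.
Proof. by rewrite card_ffun !card_ord Zp_cast. Qed.

(** Orthogonality of characters in real form. Let [al] be the phase difference along a coordinate
    where [x] and [y] differ. Shifting [k] along it gives [C (b + al) = C b], while the addition
    formula gives [C al + C (- al) = 2 * cos al * C 0]; as [cos al < 1], this forces [C 0 = 0]. *)
Lemma sum_cos_phase x y :
  \sum_k cos (phase k x - phase k y) = (x == y)%:R * N%:R ^+ d :> R.
Proof.
have [->|xy] := eqVneq x y.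
  under eq_bigr do rewrite subrr cos0.
  by rewrite sumr_const card_torus mul1r natrX.
rewrite mul0r; have [i xyi] : exists i, x i != y i.
  by apply/existsP; apply: contra_neqT xy => /existsPn H; apply/ffunP => i; apply/eqP/negPn/H.
set al : R := phase (unit_vec i) x - phase (unit_vec i) y.
pose C b : R := \sum_k cos (b + (phase k x - phase k y)).
have CD b : C (b + al) = C b.
  rewrite /C [RHS](reindex_inj (addIr (unit_vec i))) /=; apply: eq_bigr => k _.
  have s1 c z : cos (c + phase (k + unit_vec i) z) =
      cos (c + (phase k z + phase (unit_vec i) z)) :> R.
    by rewrite !(phaseC _ z) cos_phaseD.
  have s2 c z : cos (c - phase (k + unit_vec i) z) =
      cos (c - (phase k z + phase (unit_vec i) z)) :> R.
    by rewrite -cosN opprB addrC s1 -cosN; congr cos; ring.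
  by rewrite [in RHS]addrA s2 [in RHS]addrAC s1 /al; congr cos; ring.
have C0 : C al + C (- al) = 2 * cos al * C 0.
  rewrite /C -big_split mulr_sumr; apply: eq_bigr => k _ /=.
  by rewrite add0r cosD [cos (- al + _)]cosD cosN sinN; ring.
have E1 : C al = C 0 by rewrite -(CD 0) add0r.
have E2 : C (- al) = C 0 by rewrite -(CD (- al)) addNr.
have := cos_phase_diff_neq1 xyi; rewrite -/al => al1.
have -> : \sum_k cos (phase k x - phase k y) = C 0.
  by apply: eq_bigr => k _; rewrite add0r.
by move: C0; rewrite E1 E2 => C0; apply/eqP; have [//|/eqP H] := eqVneq (C 0) 0; nra.
Qed.

(** Only the constant 1 of [mu1] survives: the cosines cancel by orthogonality at the distinct
    points [unit_vec i] and 0. *)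
Lemma sum_mu1 i : \sum_(k : torus d N) mu1 (k i) = N%:R ^+ d :> R.
Proof.
have ph0 k : phase k 0 = 0 :> R.
  rewrite /phase /dotn big1 ?mulr0// => j _; by rewrite ffunE muln0.
have -> : \sum_(k : torus d N) mu1 (k i) =
    \sum_k (cos (phase k (0 : torus d N) - phase k (0 : torus d N))
            - cos (phase k (unit_vec i) - phase k (0 : torus d N))) :> R.
  by apply: eq_bigr => k _; rewrite subrr cos0 mu1E// ph0 subr0.
rewrite big_split sumrN /= !sum_cos_phase eqxx.
have -> : (unit_vec i == 0 :> torus d N) = false.
  apply/eqP => /ffunP /(_ i); rewrite !ffunE eqxx => /eqP.
  by rewrite oner_eq0.
by rewrite mul0r mul1r subr0.
Qed.

Lemma sum_lam : \sum_(k : torus d N) lam k = d%:R * N%:R ^+ d :> R.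
Proof.
rewrite exchange_big /=; under eq_bigr do rewrite sum_mu1.
by rewrite sumr_const card_ord mulr_natl.
Qed.

(** The Fourier coefficient is kept as a pair of real numbers, [hatc] and [hats], whose squared
    modulus is [hatsq]. *)
Definition hatc f k : R := \sum_x f x * cos (phase k x).
Definition hats f k : R := \sum_x f x * sin (phase k x).
Definition hatsq f k : R := hatc f k ^+ 2 + hats f k ^+ 2.

Lemma hatsq_ge0 f k : 0 <= hatsq f k.
Proof. by rewrite addr_ge0 ?sqr_ge0. Qed.

Lemma parseval2 f g :
  \sum_k (hatc f k * hatc g k + hats f k * hats g k) =
  N%:R ^+ d * \sum_x f x * g x.
Proof.
transitivity (\sum_x \sum_y f x * g y * (\sum_k cos (phase k x - phase k y))).
  under [RHS]eq_bigr do under eq_bigr do rewrite mulr_sumr.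
  under [RHS]eq_bigr do rewrite exchange_big.
  rewrite [RHS]exchange_big; apply: eq_bigr => k _.
  rewrite /hatc /hats !mulr_suml -big_split; apply: eq_bigr => x _ /=.
  rewrite !mulr_sumr -big_split; apply: eq_bigr => y _ /=.
  by rewrite cosB; ring.
rewrite mulr_sumr; apply: eq_bigr => x _.
rewrite (bigD1 x)//= sum_cos_phase eqxx big1 => [|y yx].
  by rewrite addr0 mul1r mulrC.
by rewrite sum_cos_phase eq_sym (negbTE yx) mul0r mulr0.
Qed.

Lemma parseval f : \sum_k hatsq f k = N%:R ^+ d * \sum_x f x ^+ 2.
Proof.
under [X in _ = _ * X]eq_bigr do rewrite expr2.
by rewrite -parseval2; apply: eq_bigr => k _; rewrite /hatsq !expr2.
Qed.

Lemma lapl_cosphase k x :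
  lapl (fun y => cos (phase k y)) x = 2 * lam k * cos (phase k x) :> R.
Proof.
have := lapl_cos N_gt2 (0 : R) k x; rewrite add0r => <-.
by congr (lapl _ x); apply/funext => y; rewrite add0r.
Qed.

Lemma lapl_sinphase k x :
  lapl (fun y => sin (phase k y)) x = 2 * lam k * sin (phase k x) :> R.
Proof.
rewrite sinE_cos -lapl_cos//.
by congr (lapl _ x); apply/funext => y; rewrite sinE_cos.
Qed.

Lemma hatc_lapl f k : hatc (lapl f) k = 2 * lam k * hatc f k.
Proof.
rewrite /hatc -lapl_sym// mulr_sumr; apply: eq_bigr => x _.
by rewrite lapl_cosphase; ring.
Qed.

Lemma hats_lapl f k : hats (lapl f) k = 2 * lam k * hats f k.
Proof.
rewrite /hats -lapl_sym// mulr_sumr; apply: eq_bigr => x _.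
by rewrite lapl_sinphase; ring.
Qed.

(** Averaging an edge removes half of the squared difference from the sum of squares, hence the
    factor [2^-1]. *)
Definition grad2 i f : R := 2^-1 * \sum_x (f x - f (x + unit_vec i)) ^+ 2.

(** The factor 4 counts the two orientations of an edge and undoes the [2^-1] of [grad2]. The weight
    [h] may depend on the direction of the edge only. *)
Lemma sum_grad2_edges f (w : 'I_d -> R) (h : torus d N -> torus d N -> R) :
  (forall x i, h x (x + unit_vec i) = w i) ->
  (forall x i, h (x + unit_vec i) x = w i) ->
  \sum_x \sum_(y | torus_dist x y == 1%N) (f x - f y) ^+ 2 * h x y =
  4 * \sum_i w i * grad2 i f.
Proof.
move=> h1 h2; under eq_bigr do rewrite sum_neighbours//.
rewrite exchange_big mulr_sumr; apply: eq_bigr => i _ /=.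
rewrite big_split /= [X in _ + X](reindex_inj (addIr (unit_vec i)))/=.
rewrite /grad2 -big_split/= !mulrA mulr_sumr; apply: eq_bigr => x _.
by rewrite addrK h1 h2; field.
Qed.

(** Parseval for the pair [f], [lapl f]: the Dirichlet energy in Fourier variables. It expresses the
    source through the [hatsq] themselves. *)
Lemma sum_grad2 f : N%:R ^+ d * \sum_i grad2 i f = \sum_k lam k * hatsq f k.
Proof.
apply: (@mulfI _ 2) => //.
have -> : 2 * \sum_k lam k * hatsq f k = N%:R ^+ d * \sum_x f x * lapl f x.
  rewrite -parseval2 mulr_sumr; apply: eq_bigr => k _.
  by rewrite hatc_lapl hats_lapl /hatsq; ring.
apply: (@mulfI _ 2) => //.
rewrite [RHS]mulrCA -lapl_dirichlet//.
have <- : 4 * \sum_i grad2 i f = \sum_x \sum_(y | torus_dist x y == 1%N) (f x - f y) * (f x - f y).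
  have := @sum_grad2_edges f (fun=> 1) (fun _ _ => 1) (fun _ _ => erefl) (fun _ _ => erefl).
  have -> : \sum_i 1 * grad2 i f = \sum_i grad2 i f by apply: eq_bigr => i _; rewrite mul1r.
  move=> <-; apply: eq_bigr => x _; apply: eq_bigr => y _.
  by rewrite mulr1 expr2.
ring.
Qed.

End fourier.

(** * Generators of the averaging process and of the walk *)

Section generators.
Context {R : realType} {d N : nat} (N_gt2 : (2 < N)%N).
Implicit Types (k x y z : torus d N) (f g : torus d N -> R)
  (eta : prob_mass R (torus d N)).

Let N_gt1 : (1 < N)%N. Proof. exact: ltn_trans N_gt2. Qed.

Lemma pmf_fun_continuous x : continuous (fun eta => pmf_fun eta x).
Proof.
move=> eta; apply: (@continuous_comp _ _ _ (fun eta => set_val eta) (fun p : {ptws torus d N -> R} => p x)).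
  exact: initial_continuous.
exact: (@proj_continuous _ (fun=> R) x).
Qed.

(** In this rank-one form, an update changes a linear functional by a product of two differences, as
    in [sum_average]. *)
Lemma pmf_average x y eta z :
  pmf_fun (average_pmf x y eta) z = pmf_fun eta z -
    (pmf_fun eta x - pmf_fun eta y) / 2 * ((z == x)%:R - (z == y)%:R).
Proof.
have -> : pmf_fun (average_pmf x y eta) z = average_at x y (pmf_fun eta) z.
  by rewrite /pmf_fun !set_valE.
rewrite /average_at; have [->|zx] := eqVneq z x.
  by have [->|xy] := eqVneq x y; rewrite /=; field.
by have [->|zy] := eqVneq z y; rewrite /=; field.
Qed.

Lemma sum_average (c : torus d N -> R) x y eta :
  \sum_z pmf_fun (average_pmf x y eta) z * c z =
  \sum_z pmf_fun eta z * c z -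
  (pmf_fun eta x - pmf_fun eta y) / 2 * (c x - c y).
Proof.
under eq_bigr do rewrite pmf_average mulrBl.
rewrite sumrB; congr (_ - _).
have E u : \sum_z (z == u)%:R * c z = c u.
  by rewrite (bigD1 u)//= eqxx mul1r big1 ?addr0// => z /negbTE ->; rewrite mul0r.
rewrite -(E x) -(E y) -sumrB mulr_sumr; by apply: eq_bigr => z _; ring.
Qed.

Let A (c : torus d N -> R) eta : R := \sum_z pmf_fun eta z * c z.

Lemma linear_continuous_pmf (c : torus d N -> R) : continuous (A c).
Proof.
apply: sum_continuous => z; apply: mul_fun_continuous.
  exact: pmf_fun_continuous.
exact: cst_fun_continuous.
Qed.

Lemma averaging_generator_linear (c : torus d N -> R) (l : R) eta :
  (forall x, lapl c x = 2 * l * c x) ->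
  averaging_generator (A c) eta = - l * A c eta.
Proof.
move=> Hc; rewrite /averaging_generator.
have -> : \sum_x \sum_(y | torus_dist x y == 1%N) (A c (average_pmf x y eta) - A c eta) =
   - 2^-1 * \sum_x \sum_(y | torus_dist x y == 1%N)
      (pmf_fun eta x - pmf_fun eta y) * (c x - c y).
  rewrite mulr_sumr; apply: eq_bigr => x _; rewrite mulr_sumr; apply: eq_bigr => y _.
  by rewrite /A sum_average; ring.
rewrite lapl_dirichlet// /A mulr_sumr !mulr_sumr; apply: eq_bigr => x _.
by rewrite Hc; field.
Qed.

Lemma averaging_generator_hatc k eta :
  averaging_generator (fun eta => hatc (pmf_fun eta) k) eta =
  - lam k * hatc (pmf_fun eta) k.
Proof. by apply: averaging_generator_linear => x; exact: lapl_cosphase. Qed.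

(** An update moves the coefficient by [(p x - p y) / 2] times a difference of characters. The part
    of the squared modulus linear in this increment gives the decay, by [lapl_dirichlet]. The square
    of the increment gives the source: the squared difference of characters is twice one minus the
    cosine of the phase difference, a constant along each direction. *)
Lemma averaging_generator_hatsq k eta :
  averaging_generator (fun eta => hatsq (pmf_fun eta) k) eta =
  - 2 * lam k * hatsq (pmf_fun eta) k
  + \sum_i mu1 (k i) * grad2 i (pmf_fun eta).
Proof.
rewrite /averaging_generator.
set p := pmf_fun eta.
pose E (c : torus d N -> R) := \sum_x \sum_(y | torus_dist x y == 1%N) (p x - p y) * (c x - c y).
have Ec : E (fun x => cos (phase k x)) = 4 * lam k * hatc p k.
  rewrite /E lapl_dirichlet// /hatc mulr_sumr [RHS]mulr_sumr; apply: eq_bigr => x _.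
  by rewrite lapl_cosphase//; ring.
have Es : E (fun x => sin (phase k x)) = 4 * lam k * hats p k.
  rewrite /E lapl_dirichlet// /hats mulr_sumr [RHS]mulr_sumr; apply: eq_bigr => x _.
  by rewrite lapl_sinphase//; ring.
have Q : \sum_x \sum_(y | torus_dist x y == 1%N) (p x - p y) ^+ 2 *
   (1 - cos (phase k x - phase k y)) = 4 * \sum_i mu1 (k i) * grad2 i p.
  have H x i : cos (phase k (x + unit_vec i) - phase k x) = cos (phase k (unit_vec i)) :> R.
    by rewrite [X in cos X]addrC cos_phaseD// addKr.
  apply: sum_grad2_edges => // x i; rewrite mu1E// -(H x i)//.
  by rewrite -[in RHS]cosN opprB.
have -> : \sum_x \sum_(y | torus_dist x y == 1%N)
    (hatsq (pmf_fun (average_pmf x y eta)) k - hatsq p k) =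
  - hatc p k * E (fun x => cos (phase k x)) - hats p k * E (fun x => sin (phase k x))
  + 2^-1 * \sum_x \sum_(y | torus_dist x y == 1%N) (p x - p y) ^+ 2 *
   (1 - cos (phase k x - phase k y)).
  rewrite /E !mulr_sumr -!sumrB -big_split; apply: eq_bigr => x _ /=.
  rewrite !mulr_sumr -!sumrB -big_split; apply: eq_bigr => y _ /=.
  rewrite /hatsq /hatc /hats !sum_average -/p cosB.
  have ex := cos2Dsin2 (phase k x : R); have ey := cos2Dsin2 (phase k y : R).
  set cx := cos (phase k x) in ex *; set sx := sin (phase k x) in ex *.
  set cy := cos (phase k y) in ey *; set sy := sin (phase k y) in ey *.
  have -> : 1 - (cx * cy + sx * sy) = 2^-1 * ((cx - cy) ^+ 2 + (sx - sy) ^+ 2).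
    rewrite (_ : (cx - cy) ^+ 2 + (sx - sy) ^+ 2 =
      (cx ^+ 2 + sx ^+ 2) + (cy ^+ 2 + sy ^+ 2) - 2 * (cx * cy + sx * sy)); last by ring.
    by rewrite ex ey; field.
  by field.
by rewrite Ec Es Q /hatsq; field.
Qed.

Lemma sum_grad2_pmf eta :
  \sum_i grad2 i (pmf_fun eta) = (N%:R ^+ d)^-1 * \sum_k lam k * hatsq (pmf_fun eta) k.
Proof.
rewrite -sum_grad2// mulKf// expf_neq0// pnatr_eq0 -lt0n; exact: ltn_trans N_gt1.
Qed.

Lemma hatc_continuous k : continuous (fun eta => hatc (pmf_fun eta) k).
Proof. exact: linear_continuous_pmf. Qed.

Lemma hats_continuous k : continuous (fun eta => hats (pmf_fun eta) k).
Proof. exact: linear_continuous_pmf. Qed.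

Lemma hatsq_continuous k : continuous (fun eta => hatsq (pmf_fun eta) k).
Proof.
apply: add_fun_continuous; apply: mul_fun_continuous;
  by [exact: hatc_continuous|exact: hats_continuous].
Qed.

Lemma grad2_continuous i : continuous (fun eta => grad2 i (pmf_fun eta)).
Proof.
apply: mul_fun_continuous; first exact: cst_fun_continuous.
apply: sum_continuous => x.
by apply: mul_fun_continuous; apply: sub_fun_continuous; exact: pmf_fun_continuous.
Qed.

Lemma rw_generator_eigen (c : torus d N -> R) (l : R) x :
  (forall x, lapl c x = 2 * l * c x) ->
  rw_generator (c : discrete_topology (torus d N) -> R) x = - l * c x.
Proof.
move=> Hc; rewrite /rw_generator.
have -> : \sum_(y | torus_dist x y == 1%N) (c y - c x) = - lapl c x.
  by rewrite /lapl -sumrN; apply: eq_bigr => y _; rewrite opprB.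
by rewrite Hc; field.
Qed.

End generators.

(** * Duhamel formulas *)

Section spectral_sums.
Context {R : realType} (d N : nat) (d_ge1 : (1 <= d)%N) (N_gt2 : (2 < N)%N).
Implicit Types (k : torus d N) (w : R -> R) (t u : R).

Let N_gt1 : (1 < N)%N. Proof. exact: ltn_trans N_gt2. Qed.

Let d0 : d%:R != 0 :> R. Proof. by rewrite pnatr_eq0 -lt0n. Qed.

Let n0 : N%:R ^+ d != 0 :> R.
Proof. by rewrite expf_neq0// pnatr_eq0 -lt0n; apply: ltn_trans N_gt1. Qed.

(** Exchanging two coordinates of [k] preserves [lam k], so the left-hand sum does not depend on
    [i]; averaging over [i] reconstitutes [lam]. *)
Lemma sum_lam_sym w i :
  d%:R * \sum_(k : torus d N) w (lam k) * mu1 (k i) = \sum_(k : torus d N) w (lam k) * lam k.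
Proof.
have H j : \sum_(k : torus d N) w (lam k) * mu1 (k j) = \sum_(k : torus d N) w (lam k) * mu1 (k i).
  pose h k : torus d N := [ffun l => k (tperm i j l)].
  have hK : involutive h by move=> k; apply/ffunP => l; rewrite !ffunE tpermK.
  rewrite (reindex_inj (inv_inj hK)) /=; apply: eq_bigr => k _.
  rewrite {2}/h ffunE tpermR; congr (w _ * _).
  rewrite /lam [RHS](reindex_inj (@perm_inj _ (tperm i j))) /=.
  by apply: eq_bigr => l _; rewrite ffunE.
under [RHS]eq_bigr do rewrite /lam mulr_sumr.
rewrite exchange_big /= (eq_bigr _ (fun j _ => H j)).
by rewrite sumr_const card_ord mulr_natl.
Qed.

(** The normalisation gives [id] the sum 1, see [spec_id]. *)
Definition spectral_sum w : R := (d%:R * N%:R ^+ d)^-1 * \sum_(k : torus d N) w (lam k).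

Lemma eq_spec w1 w2 : w1 =1 w2 -> spectral_sum w1 = spectral_sum w2.
Proof. by move=> H; congr (_ * _); apply: eq_bigr => k _; rewrite H. Qed.

Lemma spec_le w1 w2 : (forall k, w1 (lam k) <= w2 (lam k)) -> spectral_sum w1 <= spectral_sum w2.
Proof.
move=> H; rewrite ler_wpM2l ?invr_ge0 ?mulr_ge0 ?exprn_ge0//.
by apply: ler_sum => k _; exact: H.
Qed.

Lemma spec_ge0 w : (forall k, 0 <= w (lam k)) -> 0 <= spectral_sum w.
Proof.
move=> H; rewrite mulr_ge0 ?invr_ge0 ?mulr_ge0 ?exprn_ge0//.
by apply: sumr_ge0 => k _; exact: H.
Qed.

Lemma specD w1 w2 : spectral_sum (fun l => w1 l + w2 l) = spectral_sum w1 + spectral_sum w2.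
Proof. by rewrite /spectral_sum big_split /= mulrDr. Qed.

Lemma specZ c w : spectral_sum (fun l => c * w l) = c * spectral_sum w.
Proof. by rewrite /spectral_sum -mulr_sumr mulrCA. Qed.

Lemma spec_id : spectral_sum id = 1.
Proof. by rewrite /spectral_sum sum_lam// mulVf// mulf_neq0. Qed.

Lemma lam_le k : lam k <= 2 * d%:R :> R.
Proof.
have -> : 2 * d%:R = \sum_(i < d) 2 :> R by rewrite sumr_const card_ord mulr_natr.
by apply: ler_sum => i _; rewrite /mu1; have := cos_geN1 (2 * pi / N%:R * (k i : nat)%:R : R); lra.
Qed.

Lemma spec_derive (w dw : R -> R -> R) t :
  (forall k, is_derive t 1 (w (lam k)) (dw (lam k) t)) ->
  is_derive t 1 (fun s => spectral_sum (w^~ s)) (spectral_sum (dw^~ t)).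
Proof. by move=> H; apply: is_derive_mulcf; apply: is_derive_sumf => k. Qed.

(** By [sum_lam_sym], this is the difference of the heat kernel at time [2 t] between the origin and
    one of its neighbours. *)
Definition Kfun t : R := spectral_sum (fun l => l * expR (- 2 * l * t)).

Lemma Kfun_ge0 t : 0 <= Kfun t.
Proof. by apply: spec_ge0 => k; rewrite mulr_ge0 ?expR_ge0// lam_ge0. Qed.

Lemma Kfun_anti t u : t <= u -> Kfun u <= Kfun t.
Proof.
move=> tu; apply: spec_le => k; rewrite ler_wpM2l ?lam_ge0// ler_expR.
by rewrite !mulNr lerN2 ler_wpM2l// mulr_ge0// lam_ge0.
Qed.

Lemma Kfun_le1 t : 0 <= t -> Kfun t <= 1.
Proof.
move=> t0; rewrite -spec_id; apply: spec_le => k.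
rewrite -[leRHS]mulr1 ler_wpM2l ?lam_ge0// -expR0 ler_expR.
by rewrite !mulNr oppr_le0 !mulr_ge0// lam_ge0.
Qed.

End spectral_sums.

(* In the application [E k t] is the mean of the squared modulus of the Fourier
   coefficient at [k] of the averaging process, and [r i t] is the mean of
   [grad2 i]. *)
Record second_moments (R : realType) (d N : nat) (E : torus d N -> R -> R)
    (r : 'I_d -> R -> R) : Prop := SecondMoments {
  moment_init : forall k, E k 0 = 1 ;
  moment_ge0 : forall k (t : R), 0 <= t -> 0 <= E k t ;
  moment_grad : forall t : R, 0 <= t ->
    \sum_i r i t = (N%:R ^+ d)^-1 * \sum_k lam k * E k t ;
  moment_derive : forall k (t : R), 0 <= t ->
    is_derive t 1 (E k) (- 2 * lam k * E k t + \sum_i mu1 (k i) * r i t) }.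

(** * The renewal equation in differential form *)

Section duhamel.
Context {R : realType} (d N : nat) (d_ge1 : (1 <= d)%N) (N_gt2 : (2 < N)%N).
Implicit Types (k : torus d N) (s t u : R).
Context (E : torus d N -> R -> R) (r : 'I_d -> R -> R).
Context (M : second_moments E r).

Let E0 := moment_init M.
Let E_ge0 := moment_ge0 M.
Let Er := moment_grad M.
Let dE := moment_derive M.

Let N_gt1 : (1 < N)%N. Proof. exact: ltn_trans N_gt2. Qed.

Let d0 : d%:R != 0 :> R. Proof. by rewrite pnatr_eq0 -lt0n. Qed.

Let n0 : N%:R ^+ d != 0 :> R.
Proof. by rewrite expf_neq0// pnatr_eq0 -lt0n; apply: ltn_trans N_gt1. Qed.

Definition wsum (w : R -> R) t : R := (N%:R ^+ d)^-1 * \sum_k w (lam k) * E k t.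

Notation S := (wsum id).
Notation K := (Kfun d N).
Notation spec := (@spectral_sum R d N).

Lemma wsum_ge0 w t : (forall k, 0 <= w (lam k)) -> 0 <= t -> 0 <= wsum w t.
Proof.
move=> H t0; rewrite mulr_ge0 ?invr_ge0 ?exprn_ge0//.
by apply: sumr_ge0 => k _; rewrite mulr_ge0 ?E_ge0.
Qed.

Lemma wsum0 w : wsum w 0 = d%:R * spec w.
Proof.
rewrite /wsum /spectral_sum; under eq_bigr do rewrite E0 mulr1.
by rewrite invfM mulrA mulVKf.
Qed.

Lemma wsum_derive (w dw : R -> R -> R) t : 0 <= t ->
  (forall k, is_derive t 1 (w (lam k)) (dw (lam k) t)) ->
  is_derive t 1 (fun s => wsum (w^~ s) s)
    (wsum (fun l => dw l t - 2 * l * w l t) t + S t * spec (fun l => w l t * l)).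
Proof.
move=> t0 dw'.
have := is_derive_mulcf ((N%:R ^+ d)^-1) (is_derive_sumf (index_enum _) predT
  (fun k => is_derive_mulf (dw' k) (dE k t0))).
move=> h; apply: is_derive_eq h _.
have X : \sum_(k : torus d N) w (lam k) t * (\sum_i mu1 (k i) * r i t) =
   (\sum_i r i t) * (d%:R^-1 * \sum_(k : torus d N) w (lam k) t * lam k).
  under [LHS]eq_bigr do rewrite mulr_sumr.
  rewrite exchange_big mulr_suml; apply: eq_bigr => i _ /=.
  rewrite -(@sum_lam_sym _ _ _ (fun l => w l t) i) mulKf// mulr_sumr.
  by apply: eq_bigr => k _; ring.
have -> : \sum_k (dw (lam k) t * E k t + w (lam k) t * (- 2 * lam k * E k t + \sum_i mu1 (k i) * r i t))
  = \sum_k (dw (lam k) t - 2 * lam k * w (lam k) t) * E k t +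
    \sum_(k : torus d N) w (lam k) t * (\sum_i mu1 (k i) * r i t).
  by rewrite -big_split; apply: eq_bigr => k _ /=; ring.
rewrite X Er// /wsum /spectral_sum invfM; ring.
Qed.

(** The weight [expR (- 2 * l * (t - s))] cancels the decay of [E k] and leaves the source alone.
    Between the ends [Phi_start] and [Phi_end] this is Duhamel's formula for [wsum p t]. *)
Lemma duhamel_derive (p : R -> R) t s : 0 <= s ->
  is_derive s 1 (fun s => wsum (fun l => p l * expR (- 2 * l * (t - s))) s)
    (S s * spec (fun l => p l * l * expR (- 2 * l * (t - s)))).
Proof.
move=> s0.
have := @wsum_derive (fun l s => p l * expR (2 * l * s + - 2 * l * t))
  (fun l s => p l * (2 * l * expR (2 * l * s + - 2 * l * t))) s s0
  (fun k => is_derive_mulcf _ (is_derive_expc _ _ _)).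
have Ee l v : expR (- 2 * l * (t - v)) = expR (2 * l * v + - 2 * l * t).
  by congr expR; ring.
under [X in is_derive s 1 X]eq_fun do under eq_fun do rewrite -Ee.
move=> h; apply: is_derive_eq h _.
have -> : wsum (fun l => p l * (2 * l * expR (2 * l * s + - 2 * l * t)) -
   2 * l * (p l * expR (2 * l * s + - 2 * l * t))) s = 0.
  by rewrite /wsum big1 ?mulr0// => k _; ring.
rewrite add0r; congr (_ * _); apply: eq_spec => l; rewrite Ee; ring.
Qed.

Definition eps t : R := (N%:R ^+ d)^-1 * \sum_k (E k t - expR (- 2 * lam k * t)).

Lemma Phi_end p t : wsum (fun l => p l * expR (- 2 * l * (t - t))) t = wsum p t.
Proof.
by rewrite /wsum; congr (_ * _); apply: eq_bigr => k _; rewrite subrr mulr0 expR0 mulr1.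
Qed.

Lemma Phi_start p t : wsum (fun l => p l * expR (- 2 * l * (t - 0))) 0 =
  d%:R * spec (fun l => p l * expR (- 2 * l * t)).
Proof. by rewrite wsum0 subr0. Qed.

Lemma epsE t : eps t = wsum (fun l => 1 * expR (- 2 * l * (t - t))) t -
  wsum (fun l => 1 * expR (- 2 * l * (t - 0))) 0.
Proof.
rewrite Phi_end /eps /wsum -mulrBr; congr (_ * _); rewrite -sumrB.
by apply: eq_bigr => k _; rewrite E0 !mul1r mulr1 subr0.
Qed.

Lemma S_ge0 t : 0 <= t -> 0 <= S t.
Proof. by apply: wsum_ge0 => k; exact: lam_ge0. Qed.

Lemma S_ge_K t : 0 <= t -> d%:R * K t <= S t.
Proof.
move=> t0; rewrite -[S t]Phi_end -Phi_start.
apply: (@derive_ge0_le _ (fun s => wsum (fun l => id l * expR (- 2 * l * (t - s))) s)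
  (fun s => S s * spec (fun l => id l * l * expR (- 2 * l * (t - s))))) => [//| |].
  by move=> s /andP[s0 _]; exact: (@duhamel_derive id).
move=> s /andP[s0 st]; rewrite mulr_ge0 ?S_ge0 ?(ltW s0)//.
by apply: spec_ge0 => k; rewrite !mulr_ge0 ?lam_ge0 ?expR_ge0.
Qed.

Lemma eps_derive t s : 0 <= s ->
  is_derive s 1 (fun s => wsum (fun l => 1 * expR (- 2 * l * (t - s))) s)
    (S s * K (t - s)).
Proof.
move=> s0; apply: is_derive_eq (@duhamel_derive (fun=> 1) t s s0) _.
by congr (_ * _); apply: eq_spec => l; rewrite mul1r.
Qed.

(** Only source times up to [Num.min 1 t] are kept; there [S s >= d%:R * K 1] and
    [K (t - s) >= K t], as [K] is nonincreasing. *)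
Lemma eps_lower t : 0 <= t -> d%:R * K 1 * Num.min 1 t * K t <= eps t.
Proof.
move=> t0; rewrite epsE.
set F := fun s => wsum (fun l => 1 * expR (- 2 * l * (t - s))) s.
rewrite -[X in X - _]/(F t) -[X in _ - X]/(F 0).
set m := Num.min 1 t.
have m0 : 0 <= m by rewrite le_min ler01.
have mt : m <= t by rewrite ge_min lexx orbT.
have m1 : m <= 1 by rewrite ge_min lexx.
have F1 : F m <= F t.
  apply: (@derive_ge0_le _ F (fun s => S s * K (t - s))) => [//|s /andP[ms st]|s /andP[ms st]].
    exact/eps_derive/(le_trans m0).
  by rewrite mulr_ge0 ?Kfun_ge0// S_ge0// (le_trans m0)// ltW.
have F2 : F 0 - d%:R * K 1 * 0 * K t <= F m - d%:R * K 1 * m * K t.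
  apply: (@derive_ge0_le _ (fun s => F s - d%:R * K 1 * s * K t)
    (fun s => S s * K (t - s) - d%:R * K 1 * K t)) => [//|s /andP[s0 sm]|s /andP[s0 sm]].
    apply: is_derive_subf; first exact: eps_derive.
    have := is_derive_mulcf (d%:R * K 1 * K t) (is_derive_id s 1); rewrite mulr1.
    by rewrite (_ : (fun _ => _) = fun s => d%:R * K 1 * s * K t)//; apply/funext => v; ring.
  rewrite subr_ge0; apply: ler_pM; [by rewrite mulr_ge0// Kfun_ge0|exact: Kfun_ge0| |].
    apply: le_trans (S_ge_K (ltW s0)); rewrite ler_wpM2l//.
    by apply: Kfun_anti; rewrite (le_trans (ltW sm)).
  by apply: Kfun_anti; rewrite gerBl ltW.
by rewrite mulr0 mul0r subr0 in F2; lra.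
Qed.

(** The normalised sum of all [E k] starts at 1 and has derivative [- 2 * S + S = - S], so it stays
    below 1; each [lam k] is at most [2 * d%:R]. *)
Lemma S_le t : 0 <= t -> S t <= 2 * d%:R.
Proof.
move=> t0.
have H : wsum (fun=> 1) t <= wsum (fun=> 1) 0.
  apply: (@derive_le0_le _ (wsum (fun=> 1)) (fun s => - S s)) => [//|s /andP[s0 st]|s /andP[s0 st]].
    have := @wsum_derive (fun _ _ => 1) (fun _ _ => 0) s s0 (fun k => is_derive_cst _ _ _).
    move=> h; apply: is_derive_eq h _.
    have -> : spec (fun l => 1 * l) = 1.
      by rewrite -[RHS](spec_id d_ge1 N_gt2); apply: eq_spec => l; exact: mul1r.
    rewrite /wsum mulr1 -mulrDr -big_split -mulrN -sumrN; congr (_ * _).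
    by apply: eq_bigr => k _ /=; ring.
  by rewrite oppr_le0 S_ge0// ltW.
have H0 : wsum (fun=> 1) 0 = 1.
  rewrite /wsum; under eq_bigr do rewrite mul1r E0.
  by rewrite sumr_const card_torus// natrX mulVf.
rewrite H0 in H; apply: (@le_trans _ _ (2 * d%:R * wsum (fun=> 1) t)); last first.
  by rewrite -[leRHS]mulr1 ler_wpM2l.
rewrite /wsum mulrCA ler_wpM2l ?invr_ge0 ?exprn_ge0// mulr_sumr.
by apply: ler_sum => k _; rewrite mul1r ler_wpM2r ?E_ge0// lam_le.
Qed.

End duhamel.

(** * From the two processes to the second-moment system *)

Section second_moments.
Context {R : realType} {d N : nat} (N_gt2 : (2 < N)%N).
Implicit Types (k x y z : torus d N) (f g : torus d N -> R) (t : R).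

Let N_gt1 : (1 < N)%N. Proof. exact: ltn_trans N_gt2. Qed.

Lemma phase0 k : phase k 0 = 0 :> R.
Proof. by rewrite /phase /dotn big1 ?mulr0// => j _; rewrite ffunE muln0. Qed.

Lemma discrete_continuous (T : choiceType) (S : topologicalType)
  (f : discrete_topology T -> S) : continuous f.
Proof. by apply/continuousP => A _; exact: discrete_open. Qed.

Section walk.
Context (dW : measure_display) (W : measurableType dW) (Q : probability W R)
  (X : R -> W -> discrete_topology (torus d N)).
Context (XP : random_walk Q X (0 : torus d N)).

(** By linearity the sum is [Pt t c] at 0, and an eigenfunction makes this orbit solve the scalar
    equation of [ode_exp]. *)
Lemma rw_law_eigen (c : torus d N -> R) (l : R) t : 0 <= t ->
  (forall x, lapl c x = 2 * l * c x) ->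
  \sum_x rw_law Q X t x * c x = expR (- (l * t)) * c 0.
Proof.
move=> t0 Hc; have [[Pt [PtF PtG PtM]] _ X0] := XP.
have cont (f : discrete_topology (torus d N) -> R) : continuous f.
  exact: discrete_continuous.
have E x : rw_law Q X t x = Pt t (fun y => (y == x)%:R) 0.
  have := markov_expectation PtF PtM X0 t0 (cont (fun y => (y == x)%:R)).
  have -> : (\int[Q]_w ((X t w == x)%:R : R)%:E = \int[Q]_w (\1_[set w | X t w = x] w)%:E)%E.
    apply: eq_integral => w _; congr (_%:E); rewrite indicE.
    by case: eqP => [e|ne]; [rewrite mem_set|rewrite memNset].
  have mx : measurable [set w | X t w = x].
    by have [mX _] := PtM; exact: (mX t [set x] t0 (discrete_open _)).
  by rewrite integral_indic// setIT /rw_law => ->.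
under eq_bigr do rewrite E.
have -> : \sum_x Pt t (fun y => (y == x)%:R) 0 * c x = Pt t c 0.
  under eq_bigr do rewrite mulrC -(feller_scale PtF)//.
  rewrite -(feller_sum PtF)//; congr (Pt t _ 0); apply/funext => y.
  rewrite (bigD1 y)//= eqxx mulr1 big1 ?addr0// => x xy.
  by rewrite eq_sym (negbTE xy) mulr0.
have D (s : R) : 0 <= s -> is_derive s 1 (feller_orbit Pt rw_generator c 0)
    (- l * feller_orbit Pt rw_generator c 0 s).
  move=> s0; apply: is_derive_eq (feller_orbit_derive PtF PtG _ _ _ s0) _ => //.
  rewrite !feller_orbitE// -(feller_scale PtF)//; congr (Pt s _ 0).
  by apply/funext => x; exact: rw_generator_eigen.
by rewrite -(feller_orbitE Pt rw_generator c 0 t0) (ode_exp D t0) (feller_orbit0 PtF).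
Qed.

Lemma rw_law_hatc k t : 0 <= t -> hatc (rw_law Q X t) k = expR (- (lam k * t)).
Proof.
move=> t0; rewrite /hatc (@rw_law_eigen _ (lam k)) ?phase0 ?cos0 ?mulr1// => x.
exact: lapl_cosphase.
Qed.

Lemma rw_law_hats k t : 0 <= t -> hats (rw_law Q X t) k = 0.
Proof.
move=> t0; rewrite /hats (@rw_law_eigen _ (lam k)) ?phase0 ?sin0 ?mulr0// => x.
exact: lapl_sinphase.
Qed.

End walk.

Lemma hatc_dirac k : hatc (pmf_fun (dirac_pmf R (0 : torus d N))) k = 1.
Proof.
rewrite /hatc (bigD1 (0 : torus d N))//= big1 => [|x x0]; rewrite /pmf_fun set_valE/=.
  by rewrite phase0 cos0 eqxx mulr1 addr0.
by rewrite (negbTE x0) mul0r.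
Qed.

Lemma hats_dirac k : hats (pmf_fun (dirac_pmf R (0 : torus d N))) k = 0.
Proof.
rewrite /hats (bigD1 (0 : torus d N))//= big1 => [|x x0]; rewrite /pmf_fun set_valE/=.
  by rewrite phase0 sin0 mulr0 addr0.
by rewrite (negbTE x0) mul0r.
Qed.

Lemma l2norm_unif f g :
  l2norm (@unif R d N) (fun x => f x / unif R x - g x / unif R x) ^+ 2 =
  \sum_k hatsq (fun x => f x - g x) k.
Proof.
have N0 : N%:R ^+ d != 0 :> R by rewrite expf_neq0// pnatr_eq0 -lt0n (ltn_trans _ N_gt1).
rewrite /l2norm sqr_sqrtr; last first.
  by apply: sumr_ge0 => x _; rewrite mulr_ge0 ?sqr_ge0// invr_ge0 exprn_ge0.
rewrite parseval// mulr_sumr; apply: eq_bigr => x _.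
by rewrite real_normK ?num_real// /unif invrK -mulrBl; field.
Qed.

Lemma hatsqB f g k : hatsq (fun x => f x - g x) k =
  hatsq f k - 2 * (hatc g k * hatc f k + hats g k * hats f k) + hatsq g k.
Proof.
have Ec : hatc (fun x => f x - g x) k = hatc f k - hatc g k.
  by rewrite /hatc -sumrB; apply: eq_bigr => x _; rewrite mulrBl.
have Es : hats (fun x => f x - g x) k = hats f k - hats g k.
  by rewrite /hats -sumrB; apply: eq_bigr => x _; rewrite mulrBl.
by rewrite /hatsq Ec Es; ring.
Qed.

(** Each Fourier coefficient of the averaging process has the walk's coefficient
    [expR (- (lam k * t))] as its mean, so the cross term of the expanded square leaves [E k t]
    minus the square of that mean. *)
Lemma averaging_second_moments (dO : measure_display) (Om : measurableType dO)
    (P : probability Om R) (eta : R -> Om -> prob_mass R (torus d N))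
    (dW : measure_display) (W : measurableType dW) (Q : probability W R)
    (X : R -> W -> discrete_topology (torus d N)) :
  averaging_process P eta (dirac_pmf R (0 : torus d N)) ->
  random_walk Q X (0 : torus d N) ->
  exists (E : torus d N -> R -> R) (r : 'I_d -> R -> R),
  second_moments E r /\
      forall t, 0 <= t ->
       ('E_P[fun w => (l2norm (@unif R d N)
      (fun x => pmf_fun (eta t w) x / unif R x - rw_law Q X t x / unif R x) ^+ 2)%R])%E
       = (\sum_k (E k t - expR (- 2 * lam k * t)))%:E.
Proof.
move=> etaP XP; have [[Pt [PtF PtG PtM]] _ e0] := etaP.
set d0 := dirac_pmf R (0 : torus d N) in e0 *.
exists (fun k => feller_orbit Pt averaging_generator (fun p => hatsq (pmf_fun p) k) d0).
exists (fun i t => Pt t (fun p => grad2 i (pmf_fun p)) d0).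
have cQ k := @hatsq_continuous R d N k.
have cg i := @grad2_continuous R d N i.
have cG k : continuous (averaging_generator (fun p => @hatsq R d N (pmf_fun p) k)).
  rewrite (_ : averaging_generator _ = fun p => - 2 * lam k * hatsq (pmf_fun p) k
    + \sum_i mu1 (k i) * grad2 i (pmf_fun p)); last first.
    by apply/funext => p; exact: averaging_generator_hatsq.
  apply: add_fun_continuous; first by apply: mul_fun_continuous => //; exact: cst_fun_continuous.
  apply: sum_continuous => i.
  by apply: mul_fun_continuous => //; exact: cst_fun_continuous.
split; [split|].
- by move=> k; rewrite (feller_orbit0 PtF)// /hatsq hatc_dirac hats_dirac expr1n expr0n addr0.
- move=> k t t0; rewrite feller_orbitE//; apply: (feller_ge0 PtF) => // p.
  exact: hatsq_ge0.
- move=> t t0; rewrite -(feller_sum PtF)//.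
  under [in RHS]eq_bigr do rewrite feller_orbitE// -(feller_scale PtF)//.
  rewrite -(feller_sum PtF)//; last first.
    by move=> k; apply: mul_fun_continuous => //; exact: cst_fun_continuous.
  rewrite -(feller_scale PtF)//; last first.
    apply: sum_continuous => k; apply: mul_fun_continuous => //; exact: cst_fun_continuous.
  by congr (Pt t _ d0); apply/funext => p; exact: sum_grad2_pmf.
- move=> k t t0.
  apply: is_derive_eq (feller_orbit_derive PtF PtG _ (cQ k) (cG k) t0) _.
  rewrite !feller_orbitE// -(feller_scale PtF)//.
  under [X in _ = _ + X]eq_bigr do rewrite -(feller_scale PtF)//.
  rewrite -(feller_sum PtF)//; last first.
    by move=> i; apply: mul_fun_continuous => //; exact: cst_fun_continuous.
  rewrite -(feller_add_fun PtF)//; last 2 first.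
    by apply: mul_fun_continuous => //; exact: cst_fun_continuous.
    by apply: sum_continuous => i; apply: mul_fun_continuous => //; exact: cst_fun_continuous.
  by congr (Pt t _ d0); apply/funext => p; exact: averaging_generator_hatsq.
- move=> t t0; rewrite unlock.
  (* No [hats] occurs in the cross term because the sine coefficients of the walk started at 0
     vanish. *)
  pose F k (p : prob_mass R (torus d N)) : R := hatsq (pmf_fun p) k
     + (- 2 * expR (- (lam k * t)) * hatc (pmf_fun p) k + expR (- (lam k * t)) ^+ 2).
  have cA k : continuous (fun p => - 2 * expR (- (lam k * t)) * @hatc R d N (pmf_fun p) k).
    by apply: mul_fun_continuous; [exact: cst_fun_continuous|exact: hatc_continuous].
  have cc k : continuous (fun _ : prob_mass R (torus d N) => expR (- (lam k * t)) ^+ 2 : R).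
    exact: cst_fun_continuous.
  have cF k : continuous (F k) by do 2! apply: add_fun_continuous => //.
  have -> : (\int[P]_w ((l2norm (@unif R d N)
      (fun x => pmf_fun (eta t w) x / unif R x - rw_law Q X t x / unif R x) ^+ 2)%R)%:E
     = \int[P]_w (\sum_k F k (eta t w))%:E)%E.
    apply: eq_integral => w _; congr (_%:E); rewrite l2norm_unif.
    apply: eq_bigr => k _; rewrite hatsqB /F [hatsq (rw_law _ _ _) k]/hatsq.
    by rewrite rw_law_hatc// rw_law_hats//; ring.
  rewrite (markov_expectation (f := fun p => \sum_k F k p) PtF PtM e0 t0); last first.
    exact: sum_continuous.
  congr (_%:E); rewrite (feller_sum PtF)//; apply: eq_bigr => k _.
  rewrite feller_orbitE// (feller_add_fun PtF)//; last exact: add_fun_continuous.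
  rewrite (feller_add_fun PtF d0 t0 (cA k) (cc k)) (feller_cst PtF)//.
  rewrite (feller_scale PtF _ d0 t0 (@hatc_continuous R d N k)).
  have -> : Pt t (fun p => hatc (pmf_fun p) k) d0 = expR (- (lam k * t)).
    have cGc : averaging_generator (fun p => @hatc R d N (pmf_fun p) k) =
        fun p => - lam k * hatc (pmf_fun p) k.
      by apply/funext => p; exact: averaging_generator_hatc.
    have ch := @hatc_continuous R d N k.
    have ccGc : continuous (averaging_generator (fun p => @hatc R d N (pmf_fun p) k)).
      by rewrite cGc; apply: mul_fun_continuous => //; exact: cst_fun_continuous.
    set u := fun p => hatc (pmf_fun p) k.
    have D (s : R) : 0 <= s -> is_derive s 1 (feller_orbit Pt averaging_generator u d0)
        (- lam k * feller_orbit Pt averaging_generator u d0 s).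
      move=> s0; apply: is_derive_eq (feller_orbit_derive PtF PtG _ ch ccGc s0) _.
      by rewrite !feller_orbitE// cGc (feller_scale PtF).
    rewrite -(feller_orbitE Pt averaging_generator _ _ t0) (ode_exp D t0).
    by rewrite (feller_orbit0 PtF)// /u hatc_dirac mulr1.
  have -> : expR (- 2 * lam k * t) = expR (- (lam k * t)) ^+ 2.
    by rewrite -expRM_natl; congr expR; ring.
  ring.
Qed.

End second_moments.

(** * The tilted renewal inequality *)

Lemma geometric_limit (R : realType) (x y z : R) :
  (forall j : nat, x <= y + (3 / 4) ^+ j * z) -> x <= y.
Proof.
move=> H; have cv : y + (3 / 4) ^+ j * z @[j --> \oo] --> y + 0 * z.
  apply: cvgD; first exact: cvg_cst.
  apply: cvgM; last exact: cvg_cst.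
  by apply: cvg_expr; rewrite ger0_norm; lra.
rewrite mul0r addr0 in cv.
by apply: (cvgr_to_ge cv); apply: nearW => j; exact: H.
Qed.

Section upper.
Context {R : realType} (d N : nat) (d_ge1 : (1 <= d)%N) (N_gt2 : (2 < N)%N).
Implicit Types (k : torus d N) (s t u : R).
Context (E : torus d N -> R -> R) (r : 'I_d -> R -> R) (M : second_moments E r).
Context (rho C0 C1 Cw a : R) (om : R -> R).

Notation S := (wsum E id).
Notation K := (Kfun d N).
Notation spec := (@spectral_sum R d N).

(* [om] is the decay to be transferred from the kernel [K] to [S]; the factors
   [3 / 5] (see [spec_sq_ratio]) and [5 / 4] of [rb_om_a] multiply to [3 / 4],
   which is what makes [renewal_step] a contraction. *)
Record renewal_bounds : Prop := RenewalBounds {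
  rb_rho : 0 < rho ;
  rb_gap : forall k, lam k = 0 :> R \/ rho < 2 * lam k ;
  rb_C1 : spec (fun l => l / (2 * l - rho)) <= C1 ;
  rb_small : rho * spec (fun l => l / (2 * l - rho)) <= 5^-1 ;
  rb_K : forall t, 0 <= t -> expR (rho * t) * K t <= C0 * om t ;
  rb_om_gt0 : forall t, 0 <= t -> 0 < om t ;
  rb_om_anti : forall s t, 0 <= s -> s <= t -> om t <= om s ;
  rb_a : 0 < a < 1 ;
  rb_om_a : forall t, 0 <= t -> om (a * t) <= 5 / 4 * om t ;
  rb_om_1a : forall t, 0 <= t -> om ((1 - a) * t) <= Cw * om t ;
  rb_om_half : forall t, 0 <= t -> om (2^-1 * t) <= Cw * om t }.

Context (B : renewal_bounds).

Let St s := expR (rho * s) * S s.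

Let St_ge0 s : 0 <= s -> 0 <= St s.
Proof. by move=> s0; rewrite mulr_ge0 ?expR_ge0//; exact: (S_ge0 M). Qed.

Let gap_neq0 k : 2 * lam k - rho != 0.
Proof.
have rho0 := rb_rho B; have [->|H] := rb_gap B k.
  by rewrite mulr0 sub0r oppr_eq0 gt_eqF.
by rewrite subr_eq0 gt_eqF.
Qed.

Let ratio_ge0 k : 0 <= lam k / (2 * lam k - rho).
Proof.
have [->|H] := rb_gap B k; first by rewrite mul0r.
by rewrite divr_ge0 ?lam_ge0// subr_ge0 ltW.
Qed.

(* A Lyapunov function: [V' <= - (2 / 5) St], so that [V 0] bounds the integral
   of [St] up to a constant. *)
Let V s := wsum E (fun l => expR (rho * s + 0) * (l / (2 * l - rho))) s.

(** The left side is the total mass of the tilted kernel. Division splits it into the untilted mass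
    1/2 and [rho / 2] times the sum in [rb_small], which is at most 1/10. *)
Lemma spec_sq_ratio : spec (fun l => l * (l / (2 * l - rho))) <= 3 / 5.
Proof.
have -> : spec (fun l => l * (l / (2 * l - rho))) =
    spec (fun l => 2^-1 * l + rho / 2 * (l / (2 * l - rho))).
  rewrite /spectral_sum; congr (_ * _); apply: eq_bigr => k _.
  by field; rewrite gap_neq0.
by rewrite specD !specZ (spec_id d_ge1 N_gt2); have := rb_small B; lra.
Qed.

Let V_derive s : 0 <= s -> exists2 v, is_derive s 1 V v & v <= - (2 / 5) * St s.
Proof.
move=> s0.
have hk k : is_derive s 1 (fun s => expR (rho * s + 0) * (lam k / (2 * lam k - rho)))
    (rho * expR (rho * s + 0) * (lam k / (2 * lam k - rho))).
  have := is_derive_mulcf (lam k / (2 * lam k - rho)) (is_derive_expc rho 0 s).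
  move=> h; rewrite (_ : (fun _ => _) = fun s => lam k / (2 * lam k - rho) * expR (rho * s + 0)).
    by apply: is_derive_eq h _; ring.
  by apply/funext => v; rewrite mulrC.
have h := @wsum_derive _ _ _ d_ge1 _ _ M
  (fun l s => expR (rho * s + 0) * (l / (2 * l - rho)))
  (fun l s => rho * expR (rho * s + 0) * (l / (2 * l - rho))) s s0 hk.
eexists; first exact: h.
(* The growth of the tilt and the decay of [E k] combine into [rho - 2 * l], which cancels the
   denominator. *)
have -> : wsum E (fun l => rho * expR (rho * s + 0) * (l / (2 * l - rho)) -
    2 * l * (expR (rho * s + 0) * (l / (2 * l - rho)))) s = - St s.
  rewrite /St /wsum addr0 mulrCA -mulrN; congr (_ * _).
  rewrite mulr_sumr -sumrN; apply: eq_bigr => k _.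
  by field; rewrite gap_neq0.
have -> : spec (fun l => expR (rho * s + 0) * (l / (2 * l - rho)) * l) =
  expR (rho * s) * spec (fun l => l * (l / (2 * l - rho))).
  by rewrite addr0 -specZ; apply: eq_spec => l; ring.
have := spec_sq_ratio; have := St_ge0 s0; rewrite /St; set e := expR _.
by set x := S s; set y := spec _ => ex y3; nra.
Qed.

Let V_ge0 s : 0 <= s -> 0 <= V s.
Proof.
by move=> s0; apply: (wsum_ge0 M) => // k; rewrite mulr_ge0 ?expR_ge0.
Qed.

Let V0 : V 0 <= d%:R * C1.
Proof.
rewrite /V (wsum0 d_ge1 M)// mulr0 addr0 expR0 ler_wpM2l//.
apply: le_trans (rb_C1 B); apply: spec_le => k; by rewrite mul1r.
Qed.

(* [expR (rho * t)] times the convolution of [S] with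
   [u |-> spec (fun l => p l * l * expR (- 2 * l * u))] is estimated through the
   supremum [D] of the tilted kernel against source times [s <= b * t], and
   through the supremum [m] of [St] against source times [s >= b * t]. *)
Lemma split_bound (p : R -> R) t b D m L : 0 <= t -> 0 <= b <= 1 ->
  0 <= D -> 0 <= m -> (forall k, 0 <= p (lam k)) ->
  (forall u, (1 - b) * t <= u -> u <= t ->
    expR (rho * u) * spec (fun l => p l * l * expR (- 2 * l * u)) <= D) ->
  (forall s, b * t <= s -> s < t -> St s <= m) ->
  spec (fun l => p l * (l / (2 * l - rho))) <= L ->
  expR (rho * t) * (wsum E p t - d%:R * spec (fun l => p l * expR (- 2 * l * t)))
    <= 5 / 2 * D * (d%:R * C1) + m * L.
Proof.
move=> t0 /andP[b0 b1] D0 m0 p0 HD Hm HL.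
rewrite -[X in X - _](Phi_end E) -(Phi_start d_ge1 M).
set F := fun s => wsum E (fun l => p l * expR (- 2 * l * (t - s))) s.
rewrite -[X in _ * (X - _)]/(F t) -[X in _ - X]/(F 0).
pose G s := S s * spec (fun l => p l * l * expR (- 2 * l * (t - s))).
have dF s : 0 <= s -> is_derive s 1 F (G s).
  by move=> s0; exact: (duhamel_derive d_ge1 M).
have bt0 : 0 <= b * t by rewrite mulr_ge0.
have btt : b * t <= t by rewrite ler_piMl.
have eG s : expR (rho * t) * G s = St s *
    (expR (rho * (t - s)) * spec (fun l => p l * l * expR (- 2 * l * (t - s)))).
  have -> : expR (rho * t) = expR (rho * s) * expR (rho * (t - s)).
    by rewrite -expRD; congr expR; ring.
  by rewrite /G /St; ring.
(* Early source times: the kernel is at most [D], and [5 / 2] inverts the rate [2 / 5] at which [V]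
   pays for [St]. *)
have part1 : expR (rho * t) * (F (b * t) - F 0) <= 5 / 2 * D * (d%:R * C1).
  have : expR (rho * t) * F (b * t) + 5 / 2 * D * V (b * t) <=
         expR (rho * t) * F 0 + 5 / 2 * D * V 0.
    (* The derivative of [V] as a function of time, chosen from [V_derive], with default 0 at
       negative times. *)
    pose dV s := if pselect (0 <= s) is left s0 then s2val (cid2 (V_derive s0)) else 0.
    apply: (@derive_le0_le _ (fun s => expR (rho * t) * F s + 5 / 2 * D * V s)
      (fun s => expR (rho * t) * G s + 5 / 2 * D * dV s)) => [//|s /andP[s0 sb]|s /andP[s0 sb]].
      apply: is_derive_addf; apply: is_derive_mulcf; first exact: dF.
      by rewrite /dV; case: pselect => // s0'; case: cid2.
    have {}s0 := ltW s0.
    have dVs : dV s <= - (2 / 5) * St s.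
      by rewrite /dV; case: pselect => // s0'; case: cid2.
    have XD : expR (rho * (t - s)) * spec (fun l => p l * l * expR (- 2 * l * (t - s))) <= D.
      by apply: HD; [rewrite mulrBl mul1r; lra|lra].
    rewrite eG; move: (expR _ * spec _) XD => X XD.
    have := ler_wpM2l (St_ge0 s0) XD; have := ler_wpM2l D0 dVs; lra.
  have := V_ge0 bt0; have := V0 => h1 h2 h3.
  have h4 : 5 / 2 * D * V 0 <= 5 / 2 * D * (d%:R * C1).
    by rewrite ler_wpM2l// mulr_ge0.
  have h5 : 0 <= 5 / 2 * D * V (b * t) by rewrite mulr_ge0// mulr_ge0.
  lra.
have part2 : expR (rho * t) * (F t - F (b * t)) <= m * L.
  (* [H] is the primitive of the tilted kernel [h] that vanishes at 0; it replaces the integral over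
     late source times. *)
  pose H u := spec (fun l => p l * (l / (2 * l - rho)) * (1 - expR (- (2 * l - rho) * u + 0))).
  have H0 : H 0 = 0.
    rewrite /H /spectral_sum big1 ?mulr0// => k _.
    by rewrite mulr0 addr0 expR0 subrr mulr0.
  have HL' u : H u <= L.
    apply: le_trans HL; apply: spec_le => k.
    have c0 := mulr_ge0 (p0 k) (ratio_ge0 k).
    by rewrite -[leRHS]mulr1 ler_wpM2l// gerBl expR_ge0.
  pose h u := spec (fun l => p l * l * expR (- (2 * l - rho) * u + 0)).
  have hE u : h u = expR (rho * u) * spec (fun l => p l * l * expR (- 2 * l * u)).
    rewrite -specZ; apply: eq_spec => l.
    have -> : expR (- (2 * l - rho) * u + 0) = expR (rho * u) * expR (- 2 * l * u).
      by rewrite -expRD; congr expR; ring.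
    by ring.
  have dH s : is_derive s 1 (fun s => H (t - s)) (- h (t - s)).
    have hk k : is_derive s 1 (fun s => p (lam k) * (lam k / (2 * lam k - rho)) *
        (1 - expR ((2 * lam k - rho) * s + - (2 * lam k - rho) * t)))
        (- (p (lam k) * lam k * expR ((2 * lam k - rho) * s + - (2 * lam k - rho) * t))).
      have e0 := is_derive_subf (is_derive_cst (1 : R) s 1)
        (is_derive_expc (2 * lam k - rho) (- (2 * lam k - rho) * t) s).
      apply: is_derive_eq (is_derive_mulcf _ e0) _.
      by field; rewrite gap_neq0.
    have hd := @spec_derive R d N
     (fun l s => p l * (l / (2 * l - rho)) * (1 - expR ((2 * l - rho) * s + - (2 * l - rho) * t)))
     (fun l s => - (p l * l * expR ((2 * l - rho) * s + - (2 * l - rho) * t))) s hk.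
    have -> : - h (t - s) = spec (fun l => - (p l * l * expR ((2 * l - rho) * s + - (2 * l - rho) * t))).
      have -> : h (t - s) = spec (fun l => p l * l * expR ((2 * l - rho) * s + - (2 * l - rho) * t)).
        by apply: eq_spec => l; congr (_ * expR _); ring.
      by rewrite -mulN1r -specZ; apply: eq_spec => l; rewrite mulN1r.
    rewrite (_ : (fun s => H (t - s)) = fun s => spec (fun l => p l * (l / (2 * l - rho)) * (1 - expR ((2 * l - rho) * s + - (2 * l - rho) * t))))//.
    apply/funext => v; apply: eq_spec => l; congr (_ * (1 - expR _)); ring.
  have : expR (rho * t) * F t + m * H (t - t) <=
         expR (rho * t) * F (b * t) + m * H (t - b * t).
    apply: (@derive_le0_le _ (fun s => expR (rho * t) * F s + m * H (t - s))
      (fun s => expR (rho * t) * G s + m * - h (t - s))) => [//|s /andP[bs st]|s /andP[bs st]].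
      apply: is_derive_addf; apply: is_derive_mulcf => //.
      by apply: dF; rewrite (le_trans bt0).
    rewrite eG -hE mulrN -mulrBl mulr_le0_ge0// ?subr_le0 ?Hm// ?(ltW bs)//.
    rewrite hE mulr_ge0 ?expR_ge0//; apply: spec_ge0 => k.
    by rewrite !mulr_ge0 ?expR_ge0 ?lam_ge0.
  rewrite subrr H0 mulr0 addr0 => h1.
  have := ler_wpM2l m0 (HL' (t - b * t)); lra.
have -> : F t - F 0 = (F (b * t) - F 0) + (F t - F (b * t)) by ring.
by rewrite mulrDr lerD.
Qed.

End upper.

(** * Transfer of the decay from the kernel to the source and the error *)

Section renewal_upper.
Context {R : realType} (d N : nat) (d_ge1 : (1 <= d)%N) (N_gt2 : (2 < N)%N).
Implicit Types (k : torus d N) (s t u : R).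
Context (E : torus d N -> R -> R) (r : 'I_d -> R -> R) (M : second_moments E r).
Context (rho C0 C1 Cw a : R) (om : R -> R).
Context (B : renewal_bounds d N rho C0 C1 Cw a om).

Notation S := (wsum E id).
Notation K := (Kfun d N).
Notation spec := (@spectral_sum R d N).

Let C0_ge0 : 0 <= C0.
Proof.
have := rb_K B (lexx 0); have := rb_om_gt0 B (lexx 0) => o0 H.
rewrite -(pmulr_lge0 _ o0); apply: le_trans H.
by rewrite mulr_ge0 ?expR_ge0 ?Kfun_ge0.
Qed.

Let Cw_ge0 : 0 <= Cw.
Proof.
have := rb_om_half B (lexx 0); have := rb_om_gt0 B (lexx 0) => o0.
rewrite mulr0 => H; rewrite -(pmulr_lge0 _ o0); apply: le_trans H; exact: ltW.
Qed.

Let C1_ge0 : 0 <= C1.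
Proof.
apply: le_trans (rb_C1 B); apply: spec_ge0 => k.
have [->|H] := rb_gap B k; first by rewrite mul0r.
by rewrite divr_ge0 ?lam_ge0// subr_ge0 ltW.
Qed.

(** The first summand comes from the forcing [d%:R * K], the second from the early source times in
    [split_bound]. *)
Definition renewal_cst : R := d%:R * C0 + 5 / 2 * (2 * d%:R * C0 * Cw) * (d%:R * C1).

Let A_ge0 : 0 <= renewal_cst.
Proof. by rewrite addr_ge0// !mulr_ge0// invr_ge0. Qed.

Let kernel_bound u : 0 <= u ->
  expR (rho * u) * spec (fun l => l * l * expR (- 2 * l * u)) <= 2 * d%:R * C0 * om u.
Proof.
move=> u0; apply: (@le_trans _ _ (2 * d%:R * (expR (rho * u) * K u))).
  have -> : 2 * d%:R * (expR (rho * u) * K u) = expR (rho * u) * (2 * d%:R * K u) by ring.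
  rewrite ler_wpM2l ?expR_ge0// -specZ; apply: spec_le => k.
  by rewrite -mulrA ler_wpM2r ?mulr_ge0 ?lam_ge0 ?expR_ge0// lam_le.
by rewrite -[leRHS]mulrA ler_wpM2l ?mulr_ge0// (rb_K B).
Qed.

(** [split_bound] with [p = id] and [b = a]: late source times cost [m * (5 / 4) * (3 / 5)], which
    is [3 / 4 * m]. *)
Lemma renewal_step T m : 0 <= m ->
  (forall s, 0 <= s -> s <= T -> expR (rho * s) * S s <= m * om s) ->
  forall t, 0 <= t -> t <= T ->
    expR (rho * t) * S t <= (renewal_cst + 3 / 4 * m) * om t.
Proof.
move=> m0 H t t0 tT; have /andP[a0 a1] := rb_a B; have ot := rb_om_gt0 B t0.
have /= := @split_bound R d N d_ge1 N_gt2 E r M rho C0 C1 Cw a om B id t a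
  (2 * d%:R * C0 * Cw * om t) (m * (5 / 4 * om t)) (3 / 5) t0.
rewrite (ltW a0) (ltW a1) !mulr_ge0// ?(ltW ot)// => /(_ isT isT isT).
have h1 u : (1 - a) * t <= u -> u <= t ->
    expR (rho * u) * spec (fun l => l * l * expR (- 2 * l * u)) <= 2 * d%:R * C0 * Cw * om t.
  move=> u1 u2; have at0 : 0 <= (1 - a) * t by rewrite mulr_ge0// subr_ge0 ltW.
  apply: le_trans (kernel_bound (le_trans at0 u1)) _.
  rewrite -[leRHS]mulrA ler_wpM2l ?mulr_ge0//.
  by apply: le_trans (rb_om_1a B t0); exact: (rb_om_anti B).
have h2 s : a * t <= s -> s < t -> expR (rho * s) * S s <= m * (5 / 4 * om t).
  move=> s1 s2; have at0 : 0 <= a * t by rewrite mulr_ge0// ltW.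
  apply: le_trans (H s (le_trans at0 s1) (le_trans (ltW s2) tT)) _.
  rewrite ler_wpM2l//; apply: le_trans (rb_om_a B t0); exact: (rb_om_anti B).
move=> /(_ (fun k => lam_ge0 k) h1 h2 (spec_sq_ratio d_ge1 N_gt2 B)).
have := rb_K B t0; rewrite /renewal_cst -/(K t).
rewrite mulrBr => h3 h4.
have h5 : expR (rho * t) * (d%:R * K t) <= d%:R * (C0 * om t).
  by rewrite mulrCA ler_wpM2l.
apply: le_trans (_ : d%:R * (C0 * om t) + (5 / 2 * (2 * d%:R * C0 * Cw * om t) * (d%:R * C1)
  + m * (5 / 4 * om t) * (3 / 5)) <= _); first by lra.
by rewrite le_eqVlt; apply/orP; left; apply/eqP; field.
Qed.

(** The iteration starts from [M0], given by the a priori bound [S_le]. It depends on [t] and [N],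
    but its weight [(3 / 4) ^+ j] tends to 0, and 4 is the sum of the geometric series. *)
Lemma renewal_upper t : 0 <= t ->
  expR (rho * t) * S t <= 4 * renewal_cst * om t.
Proof.
move=> t0; have ot := rb_om_gt0 B t0; have rho0 := rb_rho B.
pose M0 := 2 * d%:R * expR (rho * t) / om t.
have M0_ge0 : 0 <= M0 by rewrite !mulr_ge0 ?expR_ge0// invr_ge0 ltW.
have iter j s : 0 <= s -> s <= t ->
    expR (rho * s) * S s <= (4 * renewal_cst + (3 / 4) ^+ j * M0) * om s.
  elim: j s => [|j IH] s s0 st.
    rewrite expr0 mul1r mulrDl; apply: ler_wpDl.
      by rewrite !mulr_ge0// ltW// (rb_om_gt0 B).
    apply: (@le_trans _ _ (expR (rho * t) * (2 * d%:R))).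
      apply: ler_pM; rewrite ?expR_ge0 ?(S_ge0 M)//.
        by rewrite ler_expR ler_pM2l.
      exact: (S_le d_ge1 N_gt2 M).
    rewrite /M0 mulrC -mulrA -[leLHS]mulr1 ler_wpM2l ?mulr_ge0 ?expR_ge0//.
    by rewrite mulrC ler_pdivlMr// mul1r (rb_om_anti B).
  have mge : 0 <= 4 * renewal_cst + (3 / 4) ^+ j * M0.
    apply: addr_ge0; first exact: mulr_ge0.
    by apply: mulr_ge0 => //; apply: exprn_ge0; apply: divr_ge0.
  apply: le_trans (renewal_step mge IH s0 st) _.
  rewrite ler_wpM2r ?(ltW (rb_om_gt0 B s0))// exprS.
  by rewrite le_eqVlt; apply/orP; left; apply/eqP; field.
have : expR (rho * t) * S t / om t <= 4 * renewal_cst.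
  apply: (@geometric_limit _ _ _ M0) => j.
  by rewrite ler_pdivrMr// iter.
by rewrite ler_pdivrMr.
Qed.

(** [split_bound] with [p = 1], whose kernel is [K]. The decay of [S] being known, no contraction is
    sought and the splitting is at [t / 2]. *)
Lemma eps_upper_om t : 0 <= t -> expR (rho * t) * eps E t <=
  (5 / 2 * (C0 * Cw) * (d%:R * C1) + 4 * renewal_cst * Cw * C1) * om t.
Proof.
move=> t0; have ot := rb_om_gt0 B t0.
have t20 : 0 <= 2^-1 * t by rewrite mulr_ge0.
have /= := @split_bound R d N d_ge1 N_gt2 E r M rho C0 C1 Cw a om B (fun=> 1) t 2^-1
  (C0 * Cw * om t) (4 * renewal_cst * (Cw * om t)) C1 t0.
have hb : 0 <= (2^-1 : R) <= 1 by lra.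
rewrite hb !mulr_ge0// ?(ltW ot)// => /(_ isT isT isT (fun=> ler01)).
have h1 u : (1 - 2^-1) * t <= u -> u <= t ->
    expR (rho * u) * spec (fun l => 1 * l * expR (- 2 * l * u)) <= C0 * Cw * om t.
  have -> : 1 - 2^-1 = 2^-1 :> R by field.
  move=> u1 u2; have u0 := le_trans t20 u1.
  have -> : spec (fun l => 1 * l * expR (- 2 * l * u)) = K u.
    by apply: eq_spec => l; rewrite mul1r.
  apply: le_trans (rb_K B u0) _; rewrite -[leRHS]mulrA ler_wpM2l//.
  by apply: le_trans (rb_om_half B t0); exact: (rb_om_anti B).
have h2 s : 2^-1 * t <= s -> s < t -> expR (rho * s) * S s <= 4 * renewal_cst * (Cw * om t).
  move=> s1 s2; apply: le_trans (renewal_upper (le_trans t20 s1)) _.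
  rewrite ler_wpM2l ?mulr_ge0//.
  by apply: le_trans (rb_om_half B t0); exact: (rb_om_anti B).
have h3 : spec (fun l => 1 * (l / (2 * l - rho))) <= C1.
  apply: le_trans (rb_C1 B); apply: spec_le => k; by rewrite mul1r.
move=> /(_ h1 h2 h3).
have -> : wsum E (fun=> 1) t - d%:R * spec (fun l => 1 * expR (- 2 * l * t)) = eps E t.
  by rewrite (epsE M) (Phi_end E) (Phi_start d_ge1 M).
by move=> H; apply: le_trans H _; rewrite le_eqVlt; apply/orP; left; apply/eqP; ring.
Qed.

(** Supplies the factor [t] of the upper bound for [t < 1], from [S <= 2 * d%:R] and [K <= 1]. *)
Lemma eps_le_linear t : 0 <= t -> eps E t <= 2 * d%:R * t.
Proof.
move=> t0; rewrite (epsE M).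
set F := fun s => wsum E (fun l => 1 * expR (- 2 * l * (t - s))) s.
rewrite -[X in X - _]/(F t) -[X in _ - X]/(F 0).
have : F t - 2 * d%:R * t <= F 0 - 2 * d%:R * 0.
  apply: (@derive_le0_le _ (fun s => F s - 2 * d%:R * s)
    (fun s => S s * K (t - s) - 2 * d%:R)) => [//|s /andP[s0 st]|s /andP[s0 st]].
    apply: is_derive_subf; first exact: (eps_derive d_ge1 M).
    by have := is_derive_mulcf (2 * d%:R) (is_derive_id s 1); rewrite mulr1.
  rewrite subr_le0 -[leRHS]mulr1; apply: ler_pM.
  - by rewrite (S_ge0 M)// ltW.
  - exact: Kfun_ge0.
  - by rewrite (S_le d_ge1 N_gt2 M)// ltW.
  - by rewrite (Kfun_le1 d_ge1 N_gt2)// subr_ge0 ltW.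
by rewrite mulr0; lra.
Qed.

End renewal_upper.

(** * Heat kernel estimates *)

Section trigonometric_bounds.
Context {R : realType}.
Implicit Types (x : R).

Lemma sin_le_id x : 0 <= x -> sin x <= x.
Proof.
move=> x0; have : sin x - x <= sin 0 - 0.
  apply: (@derive_le0_le _ (fun y => sin y - y) (fun y => cos y - 1)) => // y _.
by rewrite sin0; lra.
Qed.

(** The function [sin y - y / 2] increases up to [acos 2^-1] and decreases afterwards, so it
    suffices to check both ends; at [pi / 2] this is [pi <= 4]. *)
Lemma sin_ge_half x : 0 <= x <= pi / 2 -> x / 2 <= sin x.
Proof.
move=> /andP[x0 xp].
have h2 : -1 <= (2^-1 : R) <= 1 by lra.
pose c : R := acos 2^-1.
have cK : cos c = 2^-1 by rewrite acosK// in_itv.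
have c0 : 0 <= c by exact: acos_ge0.
have cpi : c <= pi by exact: acos_lepi.
have p0 := @pi_ge0 R; have p2 := @pihalf_lt2 R.
have dF (y : R) : is_derive y 1 (fun y => sin y - 2^-1 * y) (cos y - 2^-1).
  have h := is_derive_mulcf (2^-1) (is_derive_id y 1); rewrite mulr1 in h.
  exact: is_derive_subf (is_derive_sin y) h.
have [xc|cx] := leP x c.
  have : sin 0 - 2^-1 * 0 <= sin x - 2^-1 * x.
    apply: (@derive_ge0_le _ (fun y => sin y - 2^-1 * y) (fun y => cos y - 2^-1)) => // y /andP[y0 yx].
    rewrite subr_ge0 -cK; apply/ltW; rewrite ltr_cos ?in_itv/=; lra.
  by rewrite sin0; lra.
have : sin (pi / 2) - 2^-1 * (pi / 2) <= sin x - 2^-1 * x.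
  apply: (@derive_le0_le _ (fun y => sin y - 2^-1 * y) (fun y => cos y - 2^-1)) => // y /andP[y0 yx].
  rewrite subr_le0 -cK; apply/ltW; rewrite ltr_cos ?in_itv/=; lra.
by rewrite sin_pihalf; lra.
Qed.

(** The same formula as [mu1], on natural numbers, for sums over intervals and the reflection [n] to
    [N - n]. *)
Definition mu (N n : nat) : R := 1 - cos (2 * pi / N%:R * n%:R).

Section mu_bounds.
Context (N : nat).
Context (N_gt3 : (3 < N)%N).

Let N0 : 0 < N%:R :> R. Proof. by rewrite ltr0n; apply: leq_trans N_gt3. Qed.

Let N_neq0 : N%:R != 0 :> R. Proof. by rewrite gt_eqF. Qed.

Lemma mu_sin n : mu N n = 2 * sin (pi / N%:R * n%:R) ^+ 2.
Proof.
rewrite /mu (_ : 2 * pi / N%:R * n%:R = (pi / N%:R * n%:R) *+ 2); last first.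
  by rewrite -[RHS]mulr_natr; field.
by rewrite cos_mulr2n cos2sin2; ring.
Qed.

Lemma mu_ge0 n : 0 <= mu N n.
Proof. by rewrite subr_ge0 cos_le1. Qed.

Lemma mu_le2 n : mu N n <= 2.
Proof. by rewrite /mu; have := cos_geN1 (2 * pi / N%:R * n%:R : R); lra. Qed.

Lemma mu_0 : mu N 0 = 0.
Proof. by rewrite /mu mulr0 cos0 subrr. Qed.

Lemma mu_lower n : (2 * n <= N)%N -> 2 * (n%:R / N%:R) ^+ 2 <= mu N n.
Proof.
move=> nN; rewrite mu_sin; have p2 := @pi_ge2 R.
set y := n%:R / N%:R.
have -> : pi / N%:R * n%:R = pi * y by rewrite /y; field.
have y0 : 0 <= y by rewrite divr_ge0.
have y2 : y <= 2^-1.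
  rewrite ler_pdivrMr// mulrC ler_pdivlMr// -natrM ler_nat; lia.
have := @sin_ge_half (pi * y); rewrite mulr_ge0 ?pi_ge0//= ler_pM2l ?pi_gt0// => /(_ y2) H.
have H1 : y <= sin (pi * y) by apply: le_trans H; nra.
by rewrite ler_pM2l// ler_sqr ?nnegrE// (le_trans y0).
Qed.

Lemma mu_upper n : mu N n <= 32 * (n%:R / N%:R) ^+ 2.
Proof.
rewrite mu_sin; have p2 := @pihalf_lt2 R; have p0 := @pi_gt0 R.
set y := n%:R / N%:R.
have -> : pi / N%:R * n%:R = pi * y by rewrite /y; field.
have y0 : 0 <= y by rewrite divr_ge0.
have py : 0 <= pi * y by rewrite mulr_ge0// ltW.
have H1 : sin (pi * y) <= 4 * y by apply: le_trans (sin_le_id py) _; nra.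
have H2 : - (4 * y) <= sin (pi * y).
  have := @sin_le_id (pi * y) py.
  have : 0 <= sin (pi * y) + pi * y.
    have : sin 0 + 0 <= sin (pi * y) + pi * y.
      apply: (@derive_ge0_le _ (fun y => sin y + y) (fun y => cos y + 1)) => // z _.
    by rewrite sin0 addr0.
  by move=> h _; nra.
by nra.
Qed.

Lemma mu_sym n : (n <= N)%N -> mu N (N - n) = mu N n.
Proof.
move=> nN; rewrite /mu natrB//; congr (1 - _).
rewrite -cosN -(cosD2pi (- _)) -[pi *+ 2]mulr_natr; congr cos; field.
by [].
Qed.

(** By reflection take [2 * n <= N], where [mu] is nondecreasing; then
    [mu 2 = 2 * mu 1 * (1 + cos (2 * pi / N))] and the cosine is nonnegative for [N >= 4]. Thus
    [2 * mu n - 2 * mu 1 >= mu n] away from the gap modes. *)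
Lemma mu_gap n : (1 < n)%N -> (n < N.-1)%N -> 2 * mu N 1 <= mu N n.
Proof.
wlog nN : n / (2 * n <= N)%N => [W n1 nN|n1 _].
  have [h|h] := leqP (2 * n) N; first exact: W.
  rewrite -(@mu_sym n); last by lia.
  by apply: W; lia.
have p0 := @pi_gt0 R.
have E2 : mu N 2 = 2 * mu N 1 * (1 + cos (2 * pi / N%:R * 1)).
  rewrite /mu; set u := 2 * pi / N%:R * 1.
  have -> : 2 * pi / N%:R * 2 = u *+ 2 by rewrite /u -[RHS]mulr_natr; field.
  by rewrite cos_mulr2n -/u; ring.
have c0 : 0 <= cos (2 * pi / N%:R * 1 : R).
  have h4 : 4 <= N%:R :> R by rewrite ler_nat.
  have u0 : 0 <= 2 * pi / N%:R :> R by rewrite divr_ge0// mulr_ge0// ltW.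
  rewrite mulr1; apply: cos_ge0_pihalf; apply/andP; split; first by lra.
  by rewrite ler_pdivrMr//; nra.
have E1 : 2 * mu N 1 <= mu N 2.
  by rewrite E2 ler_peMr ?mulr_ge0 ?mu_ge0// lerDl.
apply: le_trans E1 _; rewrite /mu lerD2l lerN2.
have pN : 0 < pi / N%:R :> R by rewrite divr_gt0.
have nN' : n%:R * 2 <= N%:R :> R by rewrite -natrM ler_nat; lia.
have pNN : pi / N%:R * N%:R = pi :> R by field.
have n2 : 2 <= n%:R :> R by rewrite ler_nat.
have [->//|n2'] := eqVneq (n%:R : R) 2.
apply/ltW; rewrite ltr_cos ?in_itv/=; last 2 first.
- by apply/andP; split; nra.
- by apply/andP; split; nra.
by rewrite ltr_pM2l ?divr_gt0 ?mulr_gt0// lt_neqAle eq_sym n2'.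
Qed.

Lemma mu_ge_mu1 n : (0 < n)%N -> (n < N)%N -> mu N 1 <= mu N n.
Proof.
move=> n0 nN; have m1 := mu_ge0 1.
have [->//|n1] := eqVneq n 1%N.
have [->|n1'] := eqVneq n N.-1.
  by rewrite (_ : N.-1 = N - 1)%N; [rewrite mu_sym//; lia|lia].
by apply: le_trans (mu_gap _ _); [lra|lia|lia].
Qed.

End mu_bounds.
End trigonometric_bounds.

(** * Upper bounds for one-dimensional spectral sums *)

Section one_dimensional_sums.
Context {R : realType}.
Implicit Types (t b : R).

(** With [y = x + b], the inequality [(1 + y) ^+ 2 <= 2 * (1 + y ^+ 2)] bounds each term by
    [2 / ((1 + x) * (1 + y))], which telescopes. *)
Lemma sum_inv_sq b n : 0 < b ->
  \sum_(1 <= k < n) (1 + (b * k%:R) ^+ 2)^-1 <= 2 / b.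
Proof.
move=> b0; case: n => [|n]; first by rewrite big_geq// divr_ge0// ltW.
suff : \sum_(1 <= k < n.+1) (1 + (b * k%:R) ^+ 2)^-1 <= 2 / b * (1 - (1 + b * n%:R)^-1).
  move=> H; apply: le_trans H _; rewrite ler_piMr ?divr_ge0 ?(ltW b0)// gerBl invr_ge0.
  by rewrite addr_ge0// mulr_ge0// ltW.
elim: n => [|n IH]; first by rewrite big_geq// mulr0 addr0 invr1 subrr mulr0.
rewrite big_nat_recr//=.
set x := b * n%:R; have x0 : 0 <= x by rewrite mulr_ge0// ltW.
have -> : b * n.+1%:R = x + b by rewrite -natr1 mulrDr mulr1.
have E : 2 / b * (1 - (1 + (x + b))^-1) = 2 / b * (1 - (1 + x)^-1) + 2 / ((1 + x) * (1 + (x + b))).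
  by field; rewrite !gt_eqF//; lra.
rewrite E; apply: lerD; first exact: IH.
rewrite -[leLHS]mul1r ler_pdivrMr; last by nra.
rewrite mulrAC ler_pdivlMr; last by nra.
have h1 := sqr_ge0 (1 - (x + b)).
have h2 : (1 + x) * (1 + (x + b)) <= (1 + (x + b)) * (1 + (x + b)) by rewrite ler_wpM2r; lra.
lra.
Qed.

Lemma expRN_le y : 0 <= y -> expR (- y) <= (1 + y)^-1 :> R.
Proof.
move=> y0; rewrite expRN lef_pV2 ?posrE ?expR_gt0//; last by lra.
exact: expR_ge1Dx.
Qed.

(** [mu_lower] holds for [2 * n <= N] only; the other half is reflected, which costs the factor
    2. *)
Lemma reflect_sum_le N (F B : nat -> R) :
  (forall n, (0 < n)%N -> (n < N)%N -> (2 * n <= N)%N -> F n <= B n) ->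
  (forall n, (0 < n)%N -> (n < N)%N -> F (N - n)%N = F n) ->
  (forall n, 0 <= B n) ->
  \sum_(1 <= n < N) F n <= 2 * \sum_(1 <= n < N) B n.
Proof.
move=> FB Fs B0.
rewrite mulr_natl mulr2n [X in _ <= _ + X]big_nat_rev/= -big_split/=.
rewrite !big_nat; apply: ler_sum => n /andP[n0 nN].
rewrite add1n subSS; have [h|h] := leqP (2 * n) N.
  by apply: le_trans (FB n n0 nN h) _; rewrite lerDl.
rewrite -(Fs n)//; apply: le_trans (FB (N - n)%N _ _ _) _; [lia|lia|lia|].
by rewrite lerDr.
Qed.

Lemma sum_sq_ge n : (n%:R ^+ 3 / 3 <= \sum_(1 <= k < n.+1) k%:R ^+ 2 :> R).
Proof.
elim: n => [|n IH]; first by rewrite big_geq// expr0n mul0r.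
rewrite big_nat_recr//=; apply: le_trans (lerD IH (lexx _)).
by rewrite -natr1; have := ler0n R n; nra.
Qed.

Context (N : nat).
Context (N_gt3 : (3 < N)%N).

Let N0 : 0 < N%:R :> R. Proof. by rewrite ltr0n; apply: leq_trans N_gt3. Qed.

Let N_neq0 : N%:R != 0 :> R. Proof. by rewrite gt_eqF. Qed.

Let N1 : 1 <= N%:R :> R. Proof. by rewrite ler1n; lia. Qed.

Notation mu := (@mu R N).

(** The return probability at time [2 t] of the walk on the cycle; [kfun] is minus half its
    derivative in [t]. *)
Definition qfun t : R := N%:R^-1 * \sum_(0 <= n < N) expR (- 2 * mu n * t).
Definition kfun t : R := N%:R^-1 * \sum_(0 <= n < N) mu n * expR (- 2 * mu n * t).

Let expr_le1 n t : 0 <= t -> expR (- 2 * mu n * t) <= 1.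
Proof.
move=> t0; rewrite -expR0 ler_expR.
by rewrite !mulNr oppr_le0 !mulr_ge0// mu_ge0.
Qed.

Lemma qfun_ge0 t : 0 <= qfun t.
Proof. by rewrite mulr_ge0 ?invr_ge0// sumr_ge0// => n _; exact: expR_ge0. Qed.

Lemma qfun_le1 t : 0 <= t -> qfun t <= 1.
Proof.
move=> t0; rewrite /qfun mulrC ler_pdivrMr// mul1r.
have -> : N%:R = \sum_(0 <= n < N) 1 :> R by rewrite sumr_const_nat subn0.
by rewrite !big_nat; apply: ler_sum => n _; exact: expr_le1.
Qed.

Lemma kfun_ge0 t : 0 <= kfun t.
Proof.
rewrite mulr_ge0 ?invr_ge0// sumr_ge0// => n _.
by rewrite mulr_ge0 ?mu_ge0 ?expR_ge0.
Qed.

Lemma kfun_le2 t : 0 <= t -> kfun t <= 2.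
Proof.
move=> t0; apply: (@le_trans _ _ (2 * qfun t)); last first.
  by have := qfun_le1 t0; lra.
rewrite /qfun /kfun mulrCA ler_wpM2l ?invr_ge0// mulr_sumr.
by apply: ler_sum => n _; rewrite ler_wpM2r ?expR_ge0// mu_le2.
Qed.

Let sum_split (F : nat -> R) : \sum_(0 <= n < N) F n = F 0%N + \sum_(1 <= n < N) F n.
Proof. by rewrite big_ltn//; apply: leq_trans N_gt3. Qed.

Lemma qfun_le_sqrt t : 0 < t -> qfun t <= N%:R^-1 + 2 / Num.sqrt t.
Proof.
move=> t0; have s0 : 0 < Num.sqrt t by rewrite sqrtr_gt0.
have st : Num.sqrt t ^+ 2 = t by rewrite sqr_sqrtr// ltW.
rewrite /qfun sum_split mu_0 mulr0 mul0r expR0 mulrDr mulr1 lerD2l.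
set s := Num.sqrt t in s0 st *.
(* With this [b], [(b * n%:R) ^+ 2] is the lower bound for the exponent [2 * mu n * t] given by
   [mu_lower]. *)
pose b := 2 * s / N%:R; have b0 : 0 < b by rewrite divr_gt0// mulr_gt0.
rewrite mulrC ler_pdivrMr//.
apply: le_trans (@reflect_sum_le N _ (fun n => (1 + (b * n%:R) ^+ 2)^-1) _ _ _) _.
- move=> n n0 nN h; have H := @mu_lower R N N_gt3 n h.
  have -> : - 2 * mu n * t = - (2 * mu n * t) by ring.
  apply: le_trans (expRN_le _) _; first by rewrite !mulr_ge0 ?mu_ge0// ltW.
  rewrite lef_pV2 ?posrE; last 2 first.
  + by rewrite ltr_pwDl// !mulr_ge0 ?mu_ge0// ltW.
  + by rewrite ltr_pwDl// sqr_ge0.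
  rewrite lerD2l (_ : (b * n%:R) ^+ 2 = 2 * (2 * (n%:R / N%:R) ^+ 2) * t).
    by rewrite ler_pM2r// ler_pM2l.
  by rewrite /b -st; field.
- by move=> n n0 nN; rewrite mu_sym// ltnW.
- by move=> n; rewrite invr_ge0 addr_ge0 ?sqr_ge0.
have := sum_inv_sq N b0; have -> : 2 / b = N%:R / s by rewrite /b; field; rewrite gt_eqF.
have -> : 2 / s * N%:R = 2 * (N%:R / s) by field; rewrite gt_eqF.
lra.
Qed.

(** Away from the gap modes [mu_gap] leaves the exponent [- mu n * t], and with
    [z = (n / N) ^+ 2 * t] the prefactor [mu n] is absorbed by [z / (1 + z) ^+ 2 <= (1 + z)^-1]. *)
Lemma kfun_le_sqrt t : 0 < t ->
  expR (2 * mu 1 * t) * kfun t <= 64 / N%:R ^+ 3 + 128 / Num.sqrt t ^+ 3.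
Proof.
move=> t0; have s0 : 0 < Num.sqrt t by rewrite sqrtr_gt0.
have st : Num.sqrt t ^+ 2 = t by rewrite sqr_sqrtr// ltW.
set s := Num.sqrt t in s0 st *.
rewrite /kfun mulrCA sum_split mu_0 mul0r add0r mulr_sumr.
pose F n := expR (2 * mu 1 * t) * (mu n * expR (- 2 * mu n * t)).
rewrite -/(\sum_(1 <= n < N) F n).
pose b := s / N%:R; have b0 : 0 < b by rewrite divr_gt0.
(* The indicator isolates [n = 1], where the tilt cancels the exponential; its mirror [N - 1] is
   covered by the factor 2 of [reflect_sum_le]. *)
pose G n : R := (n == 1%N)%:R * (32 / N%:R ^+ 2) + 32 / t * (1 + (b * n%:R) ^+ 2)^-1.
have FG : \sum_(1 <= n < N) F n <= 2 * \sum_(1 <= n < N) G n.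
  apply: reflect_sum_le.
  - move=> n n0 nN h; rewrite /F /G; have [->|n1] := eqVneq n 1%N.
      rewrite mulrCA -expRD (_ : 2 * mu 1 * t + - 2 * mu 1 * t = 0); last by ring.
      rewrite expR0 mulr1 mul1r; apply: le_trans (@mu_upper R N N_gt3 1) _.
      rewrite expr_div_n expr1n mul1r lerDl mulr_ge0 ?invr_ge0 ?addr_ge0 ?sqr_ge0//.
      by rewrite divr_ge0// ltW.
    rewrite mul0r add0r mulrCA -expRD.
    have L := @mu_lower R N N_gt3 n h; have U := @mu_upper R N N_gt3 n.
    have g : 2 * mu 1 <= mu n by apply: mu_gap => //; lia.
    set y := n%:R / N%:R in L U.
    have y0 : 0 < y by rewrite divr_gt0// ltr0n.
    have e1 : expR (2 * mu 1 * t + - 2 * mu n * t) <= expR (- (2 * (y ^+ 2 * t))).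
      rewrite ler_expR; have := ler_wpM2r (ltW t0) g; have := ler_wpM2r (ltW t0) L.
      by lra.
    have by_ : b * n%:R = s * y by rewrite /b /y; field.
    have z0 : 0 < y ^+ 2 * t by rewrite mulr_gt0// exprn_gt0.
    have zE : (b * n%:R) ^+ 2 = y ^+ 2 * t by rewrite by_ -st; ring.
    rewrite zE; set z := y ^+ 2 * t in e1 z0 *.
    have e2 : expR (- (2 * z)) <= ((1 + z)^-1) ^+ 2.
      have -> : - (2 * z) = 2 * - z by ring.
      by rewrite expRM_natl ler_sqr ?nnegrE ?expR_ge0 ?invr_ge0 ?addr_ge0 ?(ltW z0)// expRN_le// ltW.
    apply: le_trans (ler_pM _ _ U (le_trans e1 e2)) _; rewrite ?mu_ge0 ?expR_ge0//.
    have -> : 32 * y ^+ 2 = 32 / t * z by rewrite /z; field; rewrite gt_eqF.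
    rewrite -[leLHS]mulrA ler_wpM2l ?divr_ge0 ?(ltW t0)//.
    rewrite expr2 mulrA ler_piMl ?invr_ge0 ?addr_ge0 ?(ltW z0)//.
    by rewrite ler_pdivrMr; lra.
  - by move=> n n0 nN; rewrite /F mu_sym// ltnW.
  - move=> n; rewrite addr_ge0// mulr_ge0 ?divr_ge0 ?exprn_ge0 ?(ltW t0)//.
    by rewrite invr_ge0 addr_ge0 ?sqr_ge0.
have GE : \sum_(1 <= n < N) G n <= 32 / N%:R ^+ 2 + 32 / t * (2 / b).
  rewrite /G big_split /= -mulr_suml -!mulr_sumr; apply: lerD.
    rewrite ler_piMl ?divr_ge0 ?exprn_ge0//.
    rewrite big_ltn ?eqxx; last by lia.
    rewrite big_nat big1 ?addr0// => n /andP[n2 _].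
    by case: eqP n2 => // ->.
  by rewrite ler_wpM2l ?divr_ge0 ?(ltW t0)// sum_inv_sq.
apply: (@le_trans _ _ (N%:R^-1 * (2 * (32 / N%:R ^+ 2 + 32 / t * (2 / b))))).
  by rewrite ler_wpM2l ?invr_ge0//; lra.
rewrite le_eqVlt; apply/orP; left; apply/eqP; rewrite /b -st; field.
by rewrite N_neq0 gt_eqF.
Qed.

End one_dimensional_sums.

(** * Two-sided one-dimensional rates in terms of the width *)

Section one_dimensional_rates.
Context {R : realType} (N : nat).
Context (N_gt3 : (3 < N)%N).
Implicit Types (t : R).

Let N0 : 0 < N%:R :> R. Proof. by rewrite ltr0n; apply: leq_trans N_gt3. Qed.

Let N1 : 1 <= N%:R :> R. Proof. by rewrite ler1n; lia. Qed.

Notation mu := (@mu R N).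

(* The typical width of the heat kernel at time [t], between one lattice spacing
   and the size of the torus. *)
Definition width t : R := Num.max (Num.min N%:R (Num.sqrt t)) 1.

Lemma width_ge1 t : 1 <= width t.
Proof. by rewrite le_max lexx orbT. Qed.

Lemma width_gt0 t : 0 < width t.
Proof. exact: lt_le_trans (width_ge1 t). Qed.

Lemma width_le_N t : width t <= N%:R.
Proof. by rewrite ge_max N1 andbT ge_min lexx. Qed.

Lemma width_le_sqrt t : 1 <= t -> width t <= Num.sqrt t.
Proof.
move=> t1; rewrite ge_max ge_min lexx orbT /=.
by rewrite -sqrtr1 ler_wsqrtr.
Qed.

Lemma width_small t : t <= 1 -> width t = 1.
Proof.
move=> t1; apply/max_idPr; rewrite ge_min; apply/orP; right.
by rewrite -sqrtr1 ler_wsqrtr.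
Qed.

Lemma width_mono t u : t <= u -> width t <= width u.
Proof.
move=> tu; rewrite ge_max !le_max lexx !orbT andbT !le_min !ge_min lexx /=.
by rewrite ler_wsqrtr// orbT.
Qed.

Lemma width_scale b t : 0 <= b <= 1 -> 0 <= t -> b * width t <= width (b * t).
Proof.
move=> /andP[b0 b1] t0; rewrite {1}/width maxr_pMr// minr_pMr// ge_max.
apply/andP; split; last by rewrite mulr1 (le_trans b1)// width_ge1.
rewrite /width le_max; apply/orP; left; rewrite le_min; apply/andP; split.
  by rewrite ge_min; apply/orP; left; rewrite ler_piMl// ltW.
rewrite ge_min; apply/orP; right; rewrite sqrtrM// ler_wpM2r ?sqrtr_ge0//.
by rewrite -ler_sqr ?nnegrE ?sqrtr_ge0// sqr_sqrtr// expr2 ler_piMr.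
Qed.

Let inv_width_N t (n : nat) : N%:R ^- n <= width t ^- n.
Proof.
rewrite lef_pV2 ?posrE ?exprn_gt0 ?width_gt0//.
by rewrite lerXn2r ?nnegrE ?width_le_N ?(ltW (width_gt0 t))// ltW.
Qed.

Let inv_width_sqrt t (n : nat) : 1 <= t -> Num.sqrt t ^- n <= width t ^- n.
Proof.
move=> t1; have s0 : 0 < Num.sqrt t by rewrite sqrtr_gt0 (lt_le_trans ltr01).
rewrite lef_pV2 ?posrE ?exprn_gt0 ?width_gt0//.
by rewrite lerXn2r ?nnegrE ?width_le_sqrt ?(ltW (width_gt0 t))// ltW.
Qed.

Lemma qfun_le t : 0 <= t -> @qfun R N t <= 3 / width t.
Proof.
move=> t0; have [t1|t1] := leP t 1.
  by rewrite width_small// divr1; have := @qfun_le1 R N N_gt3 t t0; lra.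
apply: le_trans (qfun_le_sqrt N_gt3 _) _; first by lra.
have := inv_width_N t 1; have := inv_width_sqrt 1 (ltW t1).
by rewrite !expr1; lra.
Qed.

Lemma kfun_le t : 0 <= t ->
  expR (2 * mu 1 * t) * @kfun R N t <= (192 + 2 * expR 4) / width t ^+ 3.
Proof.
move=> t0; have e4 := @expR_gt0 R 4; have [t1|t1] := leP t 1.
  rewrite width_small// expr1n divr1.
  apply: (@le_trans _ _ (expR 4 * 2)); last by lra.
  apply: ler_pM; rewrite ?expR_ge0 ?kfun_ge0 ?kfun_le2// ler_expR.
  by have := @mu_le2 R N 1; have := @mu_ge0 R N 1; nra.
apply: le_trans (kfun_le_sqrt N_gt3 _) _; first by lra.
have h1 := inv_width_N t 3; have h2 := inv_width_sqrt 3 (ltW t1).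
have h3 : 0 <= width t ^- 3 by rewrite invr_ge0 exprn_ge0// ltW// width_gt0.
by rewrite mulrDl; nra.
Qed.

(** [expR (- 100)] bounds the exponentials in [low_modes] from below; 96 is [4 ^ 3 * 3 / 2], from
    the sum of squares in [kfun_ge]. *)
Definition rate_cst : R := expR (- 100) / 96.

Lemma rate_cst_gt0 : 0 < rate_cst.
Proof. by rewrite divr_gt0// expR_gt0. Qed.

Lemma rate_cst_le1 : rate_cst <= 1.
Proof.
rewrite ler_pdivrMr// mul1r; apply: (@le_trans _ _ 1); last by lra.
by rewrite -[leRHS]expR0 ler_expR; lra.
Qed.

(** With [x = N / sqrt t >= 1], an integer [m] between [x / 4] and [x / 4 + 1] is at most
    [5 / 4 * x], so [mu n * t <= 32 * (5 / 4) ^+ 2 = 50] for [n <= m]. *)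
Let low_modes t : 1 <= t -> Num.sqrt t <= N%:R -> exists m : nat,
  [/\ (2 * m <= N)%N, N%:R / Num.sqrt t / 4 <= m%:R :> R &
      forall n, (n <= m)%N -> expR (- 100) <= expR (- 2 * mu n * t)].
Proof.
move=> t1 sN; set s := Num.sqrt t in sN *.
have s1 : 1 <= s by rewrite -sqrtr1 ler_wsqrtr.
have st : s ^+ 2 = t by rewrite sqr_sqrtr//; lra.
set x := N%:R / s.
have x1 : 1 <= x by rewrite ler_pdivlMr ?mul1r//; lra.
have xN : x <= N%:R by rewrite ler_pdivrMr ?ler_peMr//; lra.
have xs : x * s = N%:R by rewrite /x mulfVK// gt_eqF//; lra.
have [m /andP[m1 m2]] : exists m : nat, x / 4 <= m%:R <= x / 4 + 1.
  exists (Num.truncn (x / 4)).+1; have /truncn_itv /andP[h1 h2] : 0 <= x / 4 by lra.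
  by apply/andP; split; [exact: ltW|rewrite -natr1 lerD2r].
exists m; split => //.
  rewrite -(ler_nat R) natrM.
  have : 4 <= N%:R :> R by rewrite ler_nat.
  by lra.
move=> n nm; rewrite ler_expR.
have nx : n%:R <= 5 / 4 * x by apply: (@le_trans _ _ m%:R); [rewrite ler_nat|lra].
have : mu n * t <= 50.
  rewrite -st; have U := @mu_upper R N N_gt3 n.
  apply: (@le_trans _ _ (32 * (n%:R / N%:R) ^+ 2 * s ^+ 2)).
    by rewrite ler_wpM2r// sqr_ge0.
  have -> : 32 * (n%:R / N%:R) ^+ 2 * s ^+ 2 = 32 * (n%:R / x) ^+ 2.
    by rewrite -xs; field; rewrite !gt_eqF//; lra.
  have h1 : n%:R / x <= 5 / 4 by rewrite ler_pdivrMr//; lra.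
  have h2 : 0 <= n%:R / x by rewrite divr_ge0//; lra.
  by nra.
lra.
Qed.

Let sum_low_modes m (F : nat -> R) : (2 * m <= N)%N -> (forall n, 0 <= F n) ->
  \sum_(1 <= n < m.+1) F n <= \sum_(0 <= n < N) F n.
Proof.
move=> mN F0; rewrite [leRHS](@big_cat_nat _ _ _ m.+1)//=; last by lia.
rewrite [X in _ <= X + _]big_ltn// -addrA addrCA lerDl addr_ge0//.
by apply: sumr_ge0.
Qed.

Lemma qfun_ge t : 1 <= t -> rate_cst / width t <= @qfun R N t.
Proof.
move=> t1; have c0 := rate_cst_gt0; have c1 := rate_cst_le1.
have [sN|Ns] := leP (Num.sqrt t) N%:R; last first.
  have -> : width t = N%:R.
    by rewrite /width (min_idPl (ltW Ns)); apply/max_idPl.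
  rewrite /qfun mulrC ler_wpM2l ?invr_ge0// (le_trans c1)//.
  rewrite big_ltn ?(leq_trans _ N_gt3)// mu_0 mulr0 mul0r expR0 lerDl.
  by apply: sumr_ge0 => n _; exact: expR_ge0.
have s1 : 1 <= Num.sqrt t by rewrite -sqrtr1 ler_wsqrtr.
have -> : width t = Num.sqrt t.
  by rewrite /width (min_idPr sN); apply/max_idPl.
have [m [mN xm me]] := low_modes t1 sN.
rewrite /qfun [leRHS]mulrC ler_pdivlMr//.
apply: le_trans (sum_low_modes mN (fun n => expR_ge0 _)).
apply: (@le_trans _ _ (\sum_(1 <= n < m.+1) expR (- 100))); last first.
  by rewrite !big_nat; apply: ler_sum => n /andP[_ nm]; exact: me.
rewrite sumr_const_nat subSS subn0 -[leRHS]mulr_natr.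
have e0 := @expR_gt0 R (- 100).
have -> : rate_cst / Num.sqrt t * N%:R = expR (-100) * (N%:R / Num.sqrt t / 4 / 24).
  by rewrite /rate_cst; field; rewrite gt_eqF//; lra.
rewrite ler_pM2l//; apply: le_trans xm.
have : 0 <= N%:R / Num.sqrt t / 4 by rewrite !divr_ge0// sqrtr_ge0.
lra.
Qed.

(** When [sqrt t > N], the mode 1 alone suffices, as [mu 1 >= 2 / N ^+ 2]. Otherwise the modes of
    [low_modes] give the polynomial rate, and the exponential on the left is bounded by 1. *)
Lemma kfun_ge t : 1 <= t ->
  rate_cst * expR (- 2 * mu 1 * t) / width t ^+ 3 <= @kfun R N t.
Proof.
move=> t1; have c0 := rate_cst_gt0; have c1 := rate_cst_le1.
have ee := @expR_gt0 R (- 2 * mu 1 * t).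
have L1 : 2 / N%:R ^+ 2 <= mu 1.
  have := @mu_lower R N N_gt3 1 _; rewrite expr_div_n expr1n mul1r; apply; lia.
have [sN|Ns] := leP (Num.sqrt t) N%:R; last first.
  have -> : width t = N%:R.
    by rewrite /width (min_idPl (ltW Ns)); apply/max_idPl.
  apply: (@le_trans _ _ (N%:R^-1 * (mu 1 * expR (- 2 * mu 1 * t)))); last first.
    rewrite ler_wpM2l ?invr_ge0// big_ltn ?(leq_trans _ N_gt3)// mu_0 mul0r add0r.
    rewrite big_ltn ?(leq_trans _ N_gt3)// lerDl.
    by apply: sumr_ge0 => n _; rewrite mulr_ge0 ?mu_ge0 ?expR_ge0.
  have -> : rate_cst * expR (- 2 * mu 1 * t) / N%:R ^+ 3 =
     N%:R^-1 * (rate_cst / N%:R ^+ 2 * expR (- 2 * mu 1 * t)).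
    by field; rewrite gt_eqF.
  rewrite ler_wpM2l ?invr_ge0// ler_pM2r//; apply: le_trans L1.
  by rewrite ler_wpM2r ?invr_ge0 ?exprn_ge0//; lra.
have s1 : 1 <= Num.sqrt t by rewrite -sqrtr1 ler_wsqrtr.
have -> : width t = Num.sqrt t.
  by rewrite /width (min_idPr sN); apply/max_idPl.
have [m [mN xm me]] := low_modes t1 sN.
apply: (@le_trans _ _ (rate_cst / Num.sqrt t ^+ 3)).
  rewrite ler_wpM2r ?invr_ge0 ?exprn_ge0 ?sqrtr_ge0//.
  rewrite ler_piMr ?(ltW c0)// -[leRHS]expR0 ler_expR !mulNr oppr_le0 !mulr_ge0 ?mu_ge0//.
  by lra.
rewrite /kfun [leRHS]mulrC ler_pdivlMr//.
have Fge n : 0 <= mu n * expR (- 2 * mu n * t) by rewrite mulr_ge0 ?mu_ge0 ?expR_ge0.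
apply: le_trans (sum_low_modes mN Fge).
apply: (@le_trans _ _ (\sum_(1 <= n < m.+1) 2 * expR (- 100) / N%:R ^+ 2 * n%:R ^+ 2)); last first.
  rewrite !big_nat; apply: ler_sum => n /andP[n0 nm].
  have -> : 2 * expR (- 100) / N%:R ^+ 2 * n%:R ^+ 2 = 2 * (n%:R / N%:R) ^+ 2 * expR (- 100) :> R.
    by field; rewrite gt_eqF.
  apply: ler_pM; rewrite ?expR_ge0 ?mulr_ge0 ?sqr_ge0//; last exact: me.
  by apply: (mu_lower N_gt3); apply: leq_trans mN; rewrite leq_mul2l.
have e0 := @expR_gt0 R (- 100).
rewrite -mulr_sumr; apply: le_trans (ler_wpM2l _ (sum_sq_ge m)); last first.
  by rewrite !mulr_ge0 ?invr_ge0 ?exprn_ge0 ?expR_ge0.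
have x3 : (N%:R / Num.sqrt t / 4) ^+ 3 <= m%:R ^+ 3.
  by rewrite lerXn2r ?nnegrE// !divr_ge0// sqrtr_ge0.
apply: (@le_trans _ _ (2 * expR (- 100) / N%:R ^+ 2 * ((N%:R / Num.sqrt t / 4) ^+ 3 / 3))).
  by rewrite le_eqVlt; apply/orP; left; apply/eqP; rewrite /rate_cst; field; rewrite !gt_eqF//; lra.
by rewrite ler_wpM2l ?ler_wpM2r//.
Qed.

End one_dimensional_rates.

(** * Factorisation of the kernel and spectral gap on the torus *)

Section torus_spectrum.
Context {R : realType} (d N : nat) (d_ge1 : (1 <= d)%N) (N_gt3 : (3 < N)%N).
Implicit Types (k : torus d N) (t : R).

Let N_gt1 : (1 < N)%N. Proof. exact: leq_trans N_gt3. Qed.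
Let N_gt2 : (2 < N)%N. Proof. exact: leq_trans N_gt3. Qed.

Let N0 : 0 < N%:R :> R. Proof. by rewrite ltr0n; apply: leq_trans N_gt3. Qed.

Let N_neq0 : N%:R != 0 :> R. Proof. by rewrite gt_eqF. Qed.

Let d0 : d%:R != 0 :> R. Proof. by rewrite pnatr_eq0 -lt0n. Qed.

Notation mu := (@mu R N).

Lemma sum_Zp (F : nat -> R) : \sum_(a : 'Z_N) F a = \sum_(0 <= n < N) F n.
Proof. by rewrite -[RHS](congr1 (fun m => \sum_(0 <= n < m) F n) (Zp_cast N_gt1)) big_mkord. Qed.

(** The exponential factorises over coordinates, and each summand of [lam] weights a single one of
    them. *)
Lemma Kfun_prod t : Kfun d N t = qfun N t ^+ d.-1 * kfun N t.
Proof.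
pose e (a : 'Z_N) : R := expR (- 2 * mu a * t).
have expE k : expR (- 2 * lam k * t) = \prod_i e (k i).
  by rewrite /lam mulr_sumr mulr_suml expR_sum.
have H (i : 'I_d) : \sum_(k : torus d N) mu1 (k i) * expR (- 2 * lam k * t) =
    (N%:R * qfun N t) ^+ d.-1 * (N%:R * kfun N t).
  pose F (j : 'I_d) (a : 'Z_N) : R := (if j == i then mu a else 1) * e a.
  transitivity (\sum_(k : torus d N) \prod_j F j (k j)).
    apply: eq_bigr => k _; rewrite expE (bigD1 i)//= [RHS](bigD1 i)//= /F eqxx mulrA.
    by congr (_ * _); apply: eq_bigr => j /negbTE ->; rewrite mul1r.
  rewrite -bigA_distr_bigA (bigD1 i)//= mulrC; congr (_ * _).
    rewrite (eq_bigr (fun=> N%:R * qfun N t)) => [|j /negbTE ji].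
      by rewrite prodr_const cardC1 card_ord.
    rewrite /F ji; under eq_bigr do rewrite mul1r.
    by rewrite (sum_Zp (fun n => expR (- 2 * mu n * t))) /qfun mulVKf.
  rewrite /F eqxx (sum_Zp (fun n => mu n * expR (- 2 * mu n * t))).
  by rewrite /kfun mulVKf.
rewrite /Kfun /spectral_sum; under eq_bigr do rewrite {1}/lam mulr_suml.
rewrite exchange_big /= (eq_bigr _ (fun i _ => H i)) sumr_const card_ord.
rewrite -mulr_natl exprMn; case: d d_ge1 d0 => // d' _ d0'.
by rewrite exprS /=; field; rewrite N_neq0 nat1r d0' expf_neq0.
Qed.

Lemma Zp_val_eq0 (a : 'Z_N) : ((a : nat) == 0%N) = (a == 0).
Proof. by []. Qed.

(** The spectral gap with its eigenvectors: two nonzero coordinates already give [2 * mu 1], and a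
    single one is covered by [mu_gap] unless it is 1 or -1. *)
Lemma lam_cases k : [\/ k = 0,
  lam k = mu 1 /\ exists i, k = unit_vec i \/ k = - unit_vec i | 2 * mu 1 <= lam k].
Proof.
have [->|k0] := eqVneq k 0; first by apply: Or31.
have [i ki] : exists i, k i != 0.
  apply/existsP; apply: contra_neqT k0 => /existsPn H; apply/ffunP => i.
  by rewrite ffunE; apply/eqP/negPn/H.
have mu_ki (j : 'I_d) : k j != 0 -> mu 1 <= mu1 (k j).
  by move=> kj; apply: mu_ge_mu1; rewrite ?ltn_ZpN// lt0n Zp_val_eq0.
have [/existsP[j /andP[ji kj]]|/existsPn H] := boolP [exists j, (j != i) && (k j != 0)].
  apply: Or33; rewrite /lam (bigD1 i)//= (bigD1 j)//= addrA.
  have := mu_ki i ki; have := mu_ki j kj => h1 h2.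
  have : 0 <= \sum_(l | (l != i) && (l != j)) mu1 (k l) :> R.
    by apply: sumr_ge0 => l _; exact: mu1_ge0.
  by move: (\sum_(l | _) _) => z z0; lra.
have kj j : j != i -> k j = 0.
  by move=> ji; have := H j; rewrite ji /= negbK => /eqP.
have lamE : lam k = mu1 (k i) :> R.
  rewrite /lam (bigD1 i)//= big1 ?addr0// => j /kj ->.
  by rewrite /mu1 mulr0 cos0 subrr.
have kN := ltn_ZpN N_gt2 (k i).
have k1 : (0 < k i)%N by rewrite lt0n Zp_val_eq0.
have [e1|n1] := eqVneq (k i : nat) 1%N.
  apply: Or32; split; first by rewrite lamE /mu1 e1.
  exists i; left; apply/ffunP => j; rewrite ffunE.
  by have [->|/kj->//] := eqVneq j i; apply/ord_inj; rewrite e1 /= modn_small.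
have [e1|n2] := eqVneq (k i : nat) N.-1.
  apply: Or32; split.
    by rewrite lamE /mu1 e1 -(mu_sym N_gt3) ?subn1//; lia.
  exists i; right; apply/ffunP => j; rewrite !ffunE.
  have [->|/kj->] := eqVneq j i; last by rewrite oppr0.
  apply/ord_inj; rewrite e1 val_ZpN//= (@modn_small 1)// modn_small; lia.
by apply: Or33; rewrite lamE; apply: mu_gap => //; lia.
Qed.

Section shifted_ratio.
Context (theta rho : R) (theta0 : 0 < theta) (rhoE : rho = 2 * mu 1 - theta).

Lemma lam_gap k : lam k = 0 :> R \/ rho < 2 * lam k.
Proof.
have t0 := theta0; have rE := rhoE; have [->|[-> _]|h] := lam_cases k.
- by left; rewrite /lam big1// => i _; rewrite ffunE /mu1 mulr0 cos0 subrr.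
- by right; lra.
- by right; have := @mu_ge0 R N 1; lra.
Qed.

(** If [lam k >= 2 * mu 1] then [2 * lam k - rho >= lam k], so the ratio is at most 1. Gap modes
    enter through indicators, which are easily summed over [k]. *)
Lemma lam_ratio_le k : lam k / (2 * lam k - rho) <=
  1 + \sum_i ((k == unit_vec i)%:R + (k == - unit_vec i)%:R : R) * (mu 1 / theta).
Proof.
have t0 := theta0; have rE := rhoE; have m0 := @mu_ge0 R N 1.
have s0 (P : pred 'I_d) : 0 <= \sum_(i | P i)
    ((k == unit_vec i)%:R + (k == - unit_vec i)%:R) * (mu 1 / theta).
  apply: sumr_ge0 => i _; apply: mulr_ge0; first exact: addr_ge0.
  exact/divr_ge0/ltW.
have [k0|[kE [i ki]]|h] := lam_cases k.
- have -> : lam k = 0 :> R.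
    by rewrite k0 /lam big1// => i _; rewrite ffunE /mu1 mulr0 cos0 subrr.
  by rewrite mul0r addr_ge0.
- rewrite kE (bigD1 i)//=.
  have -> : 2 * mu 1 - rho = theta by rewrite rhoE; ring.
  have h1 : 1 <= (k == unit_vec i)%:R + (k == - unit_vec i)%:R :> R.
    by case: ki => ->; rewrite eqxx; [rewrite lerDl|rewrite lerDr].
  have h2 : 0 <= mu 1 / theta by rewrite divr_ge0// ltW.
  have := s0 (fun j => j != i); have := ler_wpM2r h2 h1; rewrite mul1r.
  by move: (\sum_(j | _) _) => z; lra.
- apply: (@le_trans _ _ 1); last by rewrite lerDl.
  by rewrite ler_pdivrMr; lra.
Qed.

Lemma spec_ratio_le :
  spectral_sum d N (fun l => l / (2 * l - rho)) <= 1 + 2 * mu 1 / (theta * N%:R ^+ d).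
Proof.
have n0 : 0 < N%:R ^+ d :> R by rewrite exprn_gt0.
have dp : 1 <= d%:R :> R by rewrite ler1n.
rewrite /spectral_sum.
have H : \sum_(k : torus d N) lam k / (2 * lam k - rho) <=
    N%:R ^+ d + d%:R * (2 * (mu 1 / theta)).
  apply: le_trans; first by apply: ler_sum => k _; exact: lam_ratio_le.
  rewrite big_split /= sumr_const card_torus// natrX lerD2l exchange_big /=.
  rewrite (eq_bigr (fun=> 2 * (mu 1 / theta))) => [|i _].
    by rewrite sumr_const card_ord -[leLHS]mulr_natl.
  rewrite -mulr_suml; congr (_ * _); rewrite big_split/=.
  have E (v : torus d N) : \sum_k (k == v)%:R = 1 :> R.
    by rewrite (bigD1 v)//= eqxx big1 ?addr0// => k /negbTE ->.
  by rewrite !E.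
apply: le_trans (ler_wpM2l _ H) _; first by rewrite invr_ge0 mulr_ge0// ltW.
have -> : (d%:R * N%:R ^+ d)^-1 * (N%:R ^+ d + d%:R * (2 * (mu 1 / theta))) =
   d%:R^-1 + 2 * mu 1 / (theta * N%:R ^+ d).
  by field; rewrite d0 !gt_eqF.
by rewrite lerD2r invf_le1//; lra.
Qed.

End shifted_ratio.
End torus_spectrum.

(** * Two-sided bounds *)

Section constants.
Context {R : realType} (d : nat) (d_ge1 : (1 <= d)%N).

Definition kernel_cst : R := 3 ^+ d.-1 * (192 + 2 * expR 4).

(** Chosen so that Bernoulli's inequality gives [split_ratio ^+ (d + 2) >= 4 / 5]. *)
Definition split_ratio : R := 1 - (5 * (d + 2)%:R)^-1.

(** A sum, to dominate the scaling factors at both [1 - split_ratio] and [2^-1]. *)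
Definition scale_cst : R := (1 - split_ratio) ^- (d + 2) + 2 ^+ (d + 2).

Lemma split_ratio_itv : 0 < split_ratio < 1.
Proof.
have h : 5 <= 5 * (d + 2)%:R :> R by rewrite ler_peMr// ler1n; lia.
have h1 : (5 * (d + 2)%:R)^-1 <= 5^-1 :> R by rewrite lef_pV2 ?posrE; lra.
have h2 : 0 < (5 * (d + 2)%:R)^-1 :> R by rewrite invr_gt0; lra.
by rewrite /split_ratio; apply/andP; split; lra.
Qed.

Lemma bernoulli_ge (x : R) n : 0 <= x <= 1 -> 1 - n%:R * x <= (1 - x) ^+ n.
Proof.
move=> /andP[x0 x1]; elim: n => [|n IH]; first by rewrite mul0r subr0 expr0.
rewrite exprS -natr1; have h : 0 <= 1 - x by lra.
apply: le_trans (ler_wpM2l h IH).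
have : 0 <= n%:R * x * x by rewrite !mulr_ge0.
by lra.
Qed.

Lemma split_ratio_pow : split_ratio ^- (d + 2) <= 5 / 4.
Proof.
have h0 : 0 < (d + 2)%:R :> R by rewrite ltr0n; lia.
have h2 : 0 <= ((5 * (d + 2)%:R)^-1 : R) <= 1.
  by have := split_ratio_itv; rewrite /split_ratio; lra.
have := bernoulli_ge (d + 2) h2; rewrite -/split_ratio.
have -> : (d + 2)%:R * (5 * (d + 2)%:R)^-1 = 5^-1 :> R.
  by field; move: h0; rewrite natrD => /gt_eqF ->.
set z := split_ratio ^+ (d + 2) => h; have p0 : 0 < z by lra.
by rewrite -[leLHS]mul1r ler_pdivrMr//; lra.
Qed.

Context (N : nat) (N_gt : (150 < N)%N).

Let N_gt3 : (3 < N)%N. Proof. by lia. Qed.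
Let N_gt2 : (2 < N)%N. Proof. by lia. Qed.

Let N150 : 150 <= N%:R :> R. Proof. by rewrite ler_nat ltnW. Qed.

Notation mu := (@mu R N).

Definition decay t : R := width N t ^- (d + 2).

Definition shift : R := N%:R ^- (d + 2).

Definition tilted_rate : R := 2 * mu 1 - shift.

Lemma decay_gt0 t : 0 < decay t.
Proof. by rewrite invr_gt0 exprn_gt0// width_gt0. Qed.

Lemma decay_anti t u : t <= u -> decay u <= decay t.
Proof.
move=> tu; rewrite lef_pV2 ?posrE ?exprn_gt0 ?width_gt0//.
by rewrite lerXn2r ?nnegrE ?width_mono// ltW// width_gt0.
Qed.

Lemma decay_scale b t : 0 < b <= 1 -> 0 <= t -> decay (b * t) <= b ^- (d + 2) * decay t.
Proof.
move=> /andP[b0 b1] t0; rewrite /decay -invfM -exprMn.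
rewrite lef_pV2 ?posrE ?exprn_gt0 ?width_gt0 ?mulr_gt0 ?width_gt0//.
rewrite lerXn2r ?nnegrE ?mulr_ge0 ?(ltW b0) ?(ltW (width_gt0 _ _))//.
by apply: width_scale => //; rewrite (ltW b0).
Qed.

Let mu1_le : mu 1 <= 32 / N%:R ^+ 2.
Proof. by have := @mu_upper R N N_gt3 1; rewrite expr_div_n expr1n mul1r. Qed.

Let mu1_ge : 2 / N%:R ^+ 2 <= mu 1.
Proof.
by have := @mu_lower R N N_gt3 1 (ltnW (ltnW N_gt3)); rewrite expr_div_n expr1n mul1r.
Qed.

Let shift_gt0 : 0 < shift.
Proof. by rewrite invr_gt0 exprn_gt0//; have := N150; lra. Qed.

Let shift_le : shift <= N%:R ^- 2.
Proof.
have n1 := N150; rewrite /shift addnC exprD invfM ler_piMr ?invr_ge0 ?exprn_ge0//.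
by rewrite invf_le1 ?exprn_ege1 ?exprn_gt0//; lra.
Qed.

Lemma tilted_renewal_bounds :
  renewal_bounds d N tilted_rate kernel_cst 65 scale_cst split_ratio decay.
Proof.
have n1 := N150; have m_le := mu1_le; have m_ge := mu1_ge.
have s0 := shift_gt0; have s_le := shift_le.
have N2 : 0 < N%:R ^- 2 :> R by rewrite invr_gt0 exprn_gt0//; lra.
have /andP[a0 a1] := split_ratio_itv.
have L : spectral_sum d N (fun l => l / (2 * l - tilted_rate)) <= 65.
  apply: le_trans (spec_ratio_le d_ge1 N_gt3 s0 (erefl _)) _.
  have -> : shift * N%:R ^+ d = N%:R ^- 2.
    by rewrite /shift exprD invfM mulrAC mulVf ?mul1r// expf_neq0//; lra.
  (* Hence the constant 65, as 1 + 64. *)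
  have : 2 * mu 1 / N%:R ^- 2 <= 64 by rewrite ler_pdivrMr//; lra.
  lra.
split.
- by rewrite /tilted_rate; lra.
- exact: (@lam_gap R d N d_ge1 N_gt3 _ tilted_rate s0 erefl).
- exact: L.
(* [tilted_rate] is at most [64 / N ^+ 2], and [64 * 65 / 150 ^+ 2 < 5^-1]: this is the origin of
   the bound 150. *)
- have i1 : N%:R^-1 <= 150^-1 :> R by rewrite lef_pV2 ?posrE; lra.
  have i0 : 0 <= N%:R^-1 :> R by rewrite invr_ge0.
  have N2' : N%:R ^- 2 <= 150^-1 * 150^-1 :> R.
    by rewrite -exprVn expr2; exact: ler_pM.
  apply: (@le_trans _ _ (tilted_rate * 65)).
    by rewrite ler_wpM2l// /tilted_rate; lra.
  by rewrite /tilted_rate; lra.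
- move=> t t0; rewrite (Kfun_prod d_ge1 N_gt3) /kernel_cst /decay.
  have w0 := width_gt0 N t.
  have q_le : qfun N t ^+ d.-1 <= (3 / width N t) ^+ d.-1.
    rewrite lerXn2r ?nnegrE ?qfun_ge0// ?qfun_le//.
    by rewrite divr_ge0// ltW.
  have k_le := kfun_le N_gt3 t0.
  have e_le : expR (tilted_rate * t) <= expR (2 * mu 1 * t).
    by rewrite ler_expR ler_wpM2r// /tilted_rate; lra.
  have -> : expR (tilted_rate * t) * (qfun N t ^+ d.-1 * kfun N t) =
      qfun N t ^+ d.-1 * (expR (tilted_rate * t) * kfun N t) by ring.
  have -> : 3 ^+ d.-1 * (192 + 2 * expR 4) / width N t ^+ (d + 2) =
     (3 / width N t) ^+ d.-1 * ((192 + 2 * expR 4) / width N t ^+ 3).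
    have -> : (d + 2 = d.-1 + 3)%N by rewrite -{1}(prednK d_ge1) addSnnS.
    by rewrite exprD expr_div_n; field; rewrite !expf_neq0// gt_eqF.
  apply: ler_pM => //; first by rewrite exprn_ge0// qfun_ge0.
    by rewrite mulr_ge0 ?expR_ge0 ?kfun_ge0.
  by apply: le_trans k_le; rewrite ler_wpM2r// kfun_ge0.
- by move=> t _; exact: decay_gt0.
- by move=> s t _; exact: decay_anti.
- by rewrite a0.
- move=> t t0; apply: le_trans (decay_scale _ t0) _; first by rewrite a0 ltW.
  by rewrite ler_wpM2r ?(ltW (decay_gt0 t))// split_ratio_pow.
- move=> t t0; apply: le_trans (decay_scale _ t0) _.
    by rewrite subr_gt0 a1 gerBl ltW.
  by rewrite ler_wpM2r ?(ltW (decay_gt0 t))// lerDl exprn_ge0.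
- move=> t t0; apply: le_trans (decay_scale _ t0) _.
    by rewrite invr_gt0 ltr0n invf_le1 ?ltr0n ?ler1n.
  rewrite ler_wpM2r ?(ltW (decay_gt0 t))// -exprVn invrK lerDr.
  by rewrite invr_ge0 exprn_ge0// subr_ge0 ltW.
Qed.

(** For [t < 1] monotonicity reduces to time 1, at the cost of [expR (- 4)], as [mu 1 <= 2]. *)
Lemma Kfun_lower t : 0 <= t ->
  rate_cst ^+ d * expR (- 4) * (expR (- 2 * mu 1 * t) * decay t) <= Kfun d N t.
Proof.
move=> t0; have c0 : 0 < rate_cst :> R := @rate_cst_gt0 R.
have H u : 1 <= u -> rate_cst ^+ d * (expR (- 2 * mu 1 * u) * decay u) <= Kfun d N u.
  move=> u1; rewrite (Kfun_prod d_ge1 N_gt3) /decay; have w0 := width_gt0 N u.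
  have q_ge := qfun_ge N_gt3 u1; have k_ge := kfun_ge N_gt3 u1.
  have -> : rate_cst ^+ d * (expR (- 2 * mu 1 * u) / width N u ^+ (d + 2)) =
    (rate_cst / width N u) ^+ d.-1 * (rate_cst * expR (- 2 * mu 1 * u) / width N u ^+ 3).
    have -> : (d + 2 = d.-1 + 3)%N by rewrite -{1}(prednK d_ge1) addSnnS.
    have -> : rate_cst ^+ d = rate_cst ^+ d.-1 * rate_cst :> R by rewrite -exprSr prednK.
    rewrite exprD [(_ / width N u) ^+ _]expr_div_n.
    by field; rewrite !expf_neq0// gt_eqF.
  apply: ler_pM => //.
  - by rewrite exprn_ge0// divr_ge0// ltW.
  - by rewrite divr_ge0 ?exprn_ge0 ?mulr_ge0 ?expR_ge0// ltW.
  - by rewrite lerXn2r ?nnegrE ?qfun_ge0// divr_ge0// ltW.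
have cd : 0 < rate_cst ^+ d :> R by rewrite exprn_gt0.
have [t1|t1] := leP 1 t.
  apply: le_trans (H t t1); rewrite -mulrA ler_pM2l//.
  apply: ler_piMl; first exact: mulr_ge0 (expR_ge0 _) (ltW (decay_gt0 t)).
  by rewrite -[leRHS]expR0 ler_expR; lra.
have m0 := @mu_ge0 R N 1; have m2 := @mu_le2 R N 1.
apply: le_trans (Kfun_anti d N (ltW t1)); apply: le_trans (H 1 (lexx _)).
rewrite -mulrA ler_pM2l// /decay !width_small ?(ltW t1)// expr1n invr1 !mulr1.
rewrite -expRD ler_expR.
have := mulr_ge0 m0 t0; lra.
Qed.

(** As [t ^ (d / 2 + 1)] is [sqrt t ^ (d + 2)], and powers commute with minimum and maximum, the
    denominator of [Xi] is a power of [width]. *)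
Lemma XiE t : 0 <= t -> Xi d N t = N%:R ^+ d * expR (- 2 * mu 1 * t) * decay t.
Proof.
move=> t0; rewrite /Xi /decay /t_rel /mu mulr1.
have -> : - 2 * t / (1 - cos (2 * pi / N%:R))^-1 = - 2 * (1 - cos (2 * pi / N%:R)) * t :> R.
  by rewrite invrK; ring.
congr (_ * _^-1).
have -> : t `^ (d%:R / 2 + 1) = Num.sqrt t ^+ (d + 2).
  have -> : d%:R / 2 + 1 = 2^-1 * (d + 2)%:R :> R by rewrite natrD; field.
  by rewrite powRrM powR_mulrn ?powR_ge0// powR12_sqrt.
have mono (x y : R) : 0 <= x -> 0 <= y -> Num.max (x ^+ (d + 2)) (y ^+ (d + 2)) = Num.max x y ^+ (d + 2)
   /\ Num.min (x ^+ (d + 2)) (y ^+ (d + 2)) = Num.min x y ^+ (d + 2).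
  move=> x0 y0; have [xy|yx] := leP x y.
    have h : x ^+ (d + 2) <= y ^+ (d + 2) by rewrite lerXn2r.
    by rewrite (max_idPr h) (min_idPl h).
  have h : y ^+ (d + 2) <= x ^+ (d + 2) by rewrite lerXn2r// ltW.
  by rewrite (max_idPl h) (min_idPr h).
have [_ ->] := mono N%:R (Num.sqrt t) (ler0n _ _) (sqrtr_ge0 _).
rewrite -[X in Num.max _ X](expr1n R (d + 2)).
have h0 : 0 <= Num.min N%:R (Num.sqrt t) by rewrite le_min ler0n sqrtr_ge0.
by have [-> _] := mono _ 1 h0 ler01.
Qed.

(** The last summand serves [t < 1] through [eps_le_linear], the others [t >= 1] through
    [eps_upper_om]. *)
Definition upper_cst : R :=
  5 / 2 * (kernel_cst * scale_cst) * (d%:R * 65)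
  + 4 * renewal_cst d kernel_cst 65 scale_cst * scale_cst * 65 + 2 * d%:R * expR 4.

Definition lower_cst : R := d%:R * (rate_cst ^+ d * expR (- 4)) ^+ 2 * expR (- 4).

Lemma eps_bounds (E : torus d N -> R -> R) (r : 'I_d -> R -> R) t :
  second_moments E r -> 0 <= t ->
  lower_cst * Num.min 1 t * Xi d N t <= N%:R ^+ d * eps E t /\
  N%:R ^+ d * eps E t <=
    upper_cst * Num.min 1 t * Xi d N t * expR (1 * t / N%:R ^+ (d + 2)).
Proof.
move=> M t0; have n0 : 0 < N%:R ^+ d :> R by rewrite exprn_gt0//; have := N150; lra.
have m0 := @mu_ge0 R N 1; have m2 := @mu_le2 R N 1.
have min0 : 0 <= Num.min 1 t by rewrite le_min ler01.
have dt := decay_gt0 t; have s0 := shift_gt0.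
set c : R := rate_cst ^+ d * expR (- 4).
have c0 : 0 < c by rewrite mulr_gt0 ?exprn_gt0 ?expR_gt0// rate_cst_gt0.
rewrite XiE//; split.
  have h := eps_lower d_ge1 M t0.
  have K1 : c * expR (- 4) <= Kfun d N 1.
    apply: le_trans (Kfun_lower ler01); rewrite ler_pM2l// /decay width_small//.
    by rewrite expr1n invr1 !mulr1 ler_expR; lra.
  have Kt := Kfun_lower t0; rewrite -/c in Kt.
  have cE : lower_cst = d%:R * (c * expR (- 4)) * c by rewrite /lower_cst -/c; ring.
  rewrite cE; set e := expR (- 2 * mu 1 * t) in Kt *.
  have -> : d%:R * (c * expR (- 4)) * c * Num.min 1 t * (N%:R ^+ d * e * decay t) =
     N%:R ^+ d * (d%:R * (c * expR (- 4)) * Num.min 1 t * (c * (e * decay t))) by ring.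
  rewrite ler_pM2l//; apply: le_trans h.
  have ce : 0 <= c * expR (- 4) := mulr_ge0 (ltW c0) (expR_ge0 _).
  have ed : 0 <= e * decay t := mulr_ge0 (expR_ge0 _) (ltW dt).
  apply: ler_pM; last exact: Kt.
  - by apply: mulr_ge0 => //; exact: mulr_ge0.
  - by apply: mulr_ge0 => //; exact: ltW.
  - by rewrite ler_wpM2r// ler_wpM2l.
have B := tilted_renewal_bounds.
have u1 := eps_upper_om d_ge1 N_gt2 M B t0.
have u2 := eps_le_linear d_ge1 N_gt2 M t0.
set D := 5 / 2 * (kernel_cst * scale_cst) * (d%:R * 65)
  + 4 * renewal_cst d kernel_cst 65 scale_cst * scale_cst * 65 in u1.
have uE : upper_cst = D + 2 * d%:R * expR 4 by [].
have L0 : 0 <= 2 * d%:R * expR 4 :> R by rewrite mulr_ge0 ?expR_ge0.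
(* The tilt falls short of [2 * mu 1] by [shift], which is exactly what the correction factor
   repays. *)
have eE : expR (- 2 * mu 1 * t) * expR (1 * t / N%:R ^+ (d + 2)) = expR (- (tilted_rate * t)).
  by rewrite -expRD; congr expR; rewrite /tilted_rate /shift; ring.
have -> : upper_cst * Num.min 1 t * (N%:R ^+ d * expR (- 2 * mu 1 * t) * decay t) *
    expR (1 * t / N%:R ^+ (d + 2)) =
  N%:R ^+ d * (upper_cst * Num.min 1 t * decay t *
    (expR (- 2 * mu 1 * t) * expR (1 * t / N%:R ^+ (d + 2)))) by ring.
rewrite eE ler_pM2l// expRN ler_pdivlMr ?expR_gt0// mulrC.
have eps0 : 0 <= expR (tilted_rate * t) by exact: expR_ge0.
have e0 : 0 <= eps E t.
  apply: le_trans (eps_lower d_ge1 M t0).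
  exact: mulr_ge0 (mulr_ge0 (mulr_ge0 (ler0n _ _) (Kfun_ge0 _ _ _)) min0) (Kfun_ge0 _ _ _).
have D0 : 0 <= D.
  by rewrite -(pmulr_lge0 _ dt); apply: le_trans u1; rewrite mulr_ge0.
have [t1|t1] := leP 1 t.
  rewrite mulr1; apply: le_trans u1 _; rewrite ler_wpM2r ?(ltW dt)//.
  by rewrite uE lerDl.
rewrite /decay width_small ?(ltW t1)// expr1n invr1 mulr1.
have r4 : expR (tilted_rate * t) <= expR 4.
  rewrite ler_expR; have := shift_gt0 => s1.
  have h : tilted_rate <= 4 by rewrite /tilted_rate; lra.
  have h' : 4 * t <= 4 by lra.
  by apply: le_trans h'; rewrite ler_wpM2r.
apply: (@le_trans _ _ (expR 4 * (2 * d%:R * t))); first exact: ler_pM.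
have -> : expR 4 * (2 * d%:R * t) = 2 * d%:R * expR 4 * t by ring.
by rewrite ler_wpM2r// uE lerDr.
Qed.

Lemma upper_cst_gt0 : 0 < upper_cst.
Proof.
have d0 : 0 < d%:R :> R by rewrite ltr0n.
have a1 : split_ratio < 1 by have /andP[] := split_ratio_itv.
have k0 : 0 <= kernel_cst by rewrite mulr_ge0 ?exprn_ge0// addr_ge0// mulr_ge0// expR_ge0.
have s0 : 0 <= scale_cst by rewrite addr_ge0 ?invr_ge0 ?exprn_ge0// subr_ge0 ltW.
have r0 : 0 <= renewal_cst d kernel_cst 65 scale_cst.
  by rewrite /renewal_cst addr_ge0// !mulr_ge0// invr_ge0.
rewrite /upper_cst ltr_wpDl ?mulr_gt0 ?expR_gt0//.
by rewrite addr_ge0// !mulr_ge0// invr_ge0.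
Qed.

Lemma lower_cst_gt0 : 0 < lower_cst.
Proof.
have d0 : 0 < d%:R :> R by rewrite ltr0n.
have c0 : 0 < rate_cst ^+ d * expR (- 4) :> R.
  exact: mulr_gt0 (exprn_gt0 _ (rate_cst_gt0 (R := R))) (expR_gt0 _).
exact: mulr_gt0 (mulr_gt0 d0 (exprn_gt0 _ c0)) (expR_gt0 _).
Qed.

End constants.

Theorem theorem2p4 (R : realType) (d : nat) (d_ge1 : (1 <= d)%N) :
  exists B C1 C2 : R, [/\ 0 < B, 0 < C1, 0 < C2 &
  exists N0 : nat, forall N : nat, (N0 <= N)%N -> (1 < N)%N ->
  forall (dO : measure_display) (Om : measurableType dO) (P : probability Om R)
    (eta : R -> Om -> prob_mass R (torus d N)),
  averaging_process P eta (dirac_pmf R (0 : torus d N)) ->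
  forall (dW : measure_display) (W : measurableType dW) (Q : probability W R)
    (X : R -> W -> discrete_topology (torus d N)),
  random_walk Q X (0 : torus d N) ->
  forall t : R, 0 <= t ->
  let error := ('E_P[fun w => (l2norm (@unif R d N)
      (fun x => pmf_fun (eta t w) x / unif R x - rw_law Q X t x / unif R x) ^+ 2)%R])%E in
  ((C1 * Num.min 1 t * Xi d N t)%:E <= error)%E /\
  (error <= (C2 * Num.min 1 t * Xi d N t * expR (B * t / N%:R ^+ (d + 2)))%:E)%E].
Proof.
(* [B = 1] is the coefficient of [shift] in [tilted_rate]. *)
exists 1, (lower_cst d), (upper_cst d); split=> //.
- exact: lower_cst_gt0.
- exact: upper_cst_gt0.
exists 151%N => N N_gt _ dO Om P eta etaP dW W Q X XP t t0 error.
have N_gt2 : (2 < N)%N by apply: leq_trans N_gt.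
have [E [r [M errE]]] := averaging_second_moments N_gt2 etaP XP.
have n0 : N%:R ^+ d != 0 :> R by rewrite expf_neq0// pnatr_eq0 -lt0n; apply: leq_trans N_gt.
have -> : error = (N%:R ^+ d * eps E t)%:E by rewrite /error errE// /eps mulVKf.
by rewrite !lee_fin; exact: (eps_bounds d_ge1 N_gt M t0).
Qed.
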